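(* Let $A$ be a dilation on $\mathbb{R}^n$, $1\le p<\infty$, $\theta>0$, $q(\cdot)\in\mathcal{P}(\mathbb{R}^n)$, and let $\alpha(\cdot)\in L^\infty(\mathbb{R}^n)$ be a real-valued function which is log-H\''older continuous at the origin and at infinity, with $0<\alpha(0),\alpha_\infty<\infty$. The following two statements are equivalent: (i) $f\in \dot{K}^{\alpha(\cdot),p)}_{q(\cdot),\theta}(A;\mathbb{R}^n)$. (ii) $f$ can be represented by $$f(x)=\sum_{k=-\infty}^{\infty}\lambda_k a_k(x),$$ where each $a_k$ is a central $(\alpha(\cdot),q(\cdot))$-block with support contained in $B_k$ and $$\sup_{\varepsilon>0}\Big(\varepsilon^\theta\sum_{k=-\infty}^\infty|\lambda_k|^{p(1+\varepsilon)}\Big)^{\frac{1}{p(1+\varepsilon)}}<\infty .$$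
   Context: Dilations. A dilation is a real $n\times n$ matrix $A$ all of whose eigenvalues $\lambda$ satisfy $|\lambda|>1$; $b=|\det A|$. Fix an ellipsoid $\Delta=\{x\in\mathbb{R}^n:|Px|<1\}$ ($P$ a nondegenerate $n\times n$ matrix) with $|\Delta|=1$ and a number $r>1$ such that $\Delta\subset r\Delta\subset A\Delta$. For $k\in\mathbb{Z}$ put $B_k=A^k\Delta$ (so $|B_k|=b^k$ and $B_k\subset rB_k\subset B_{k+1}$), $C_k=B_k\setminus B_{k-1}$, $\chi_k=\chi_{C_k}$. Variable exponents. $\mathcal{P}(\mathbb{R}^n)$ is the set of measurable $q(\cdot):\mathbb{R}^n\to[1,\infty)$ with $q^-=\operatorname{ess\,inf} q>1$ and $q^+=\operatorname{ess\,sup}q<\infty$. The norm is $\|f\|_{L^{q(\cdot)}(\mathbb{R}^n)}=\inf\{\lambda>0:\int_{\mathbb{R}^n}(|f(x)|/\lambda)^{q(x)}dx\le1\}$. $L^{q(\cdot)}_{\rm loc}(\Omega)$ is the set of $f$ with $f\in L^{q(\cdot)}(E)$ for all compact $E\subset\Omega$. A function $g:\mathbb{R}^n\to\mathbb{R}$ is log-H\''older continuous at the origin if there is $C>0$ with $|g(x)-g(0)|\le C/\log(e+1/|x|)$ for all $x$, and log-H\''older continuous at infinity if there are $g_\infty\in\mathbb{R}$ and $C>0$ with $|g(x)-g_\infty|\le C/\log(e+|x|)$ for all $x$. $\alpha_\infty$ denotes this limit for $\alpha(\cdot)$. Space. $\dot{K}^{\alpha(\cdot),p)}_{q(\cdot),\theta}(A;\mathbb{R}^n)$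 is the set of $f\in L^{q(\cdot)}_{\rm loc}(\mathbb{R}^n\setminus\{0\})$ with $$\|f\|_{\dot{K}^{\alpha(\cdot),p)}_{q(\cdot),\theta}(A;\mathbb{R}^n)}=\sup_{\varepsilon>0}\Big(\varepsilon^\theta\sum_{k=-\infty}^\infty\|b^{k\alpha(\cdot)}f\chi_k\|_{L^{q(\cdot)}(\mathbb{R}^n)}^{p(1+\varepsilon)}\Big)^{\frac1{p(1+\varepsilon)}}<\infty.$$ Blocks. Put $\alpha_l=\alpha(0)$ for $l<0$ and $\alpha_l=\alpha_\infty$ for $l\ge0$. A measurable function $a$ is a central $(\alpha(\cdot),q(\cdot))$-block with support contained in $B_l$ ($l\in\mathbb{Z}$) if $\operatorname{supp}a\subset B_l$ and $\|a\|_{L^{q(\cdot)}(\mathbb{R}^n)}\le b^{-l\alpha_l}$. *)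

(* Defs.v *)
From HB Require Import structures.
From mathcomp Require Import all_boot all_order all_algebra.
From mathcomp Require Import complex.
From mathcomp Require Import all_classical all_reals all_analysis.
From mathcomp Require Import ess_sup_inf.

Set Implicit Arguments.
Unset Strict Implicit.
Unset Printing Implicit Defensive.

Import Order.TTheory GRing.Theory Num.Theory.
Import numFieldNormedType.Exports.

Local Open Scope classical_set_scope.
Local Open Scope ring_scope.

(* Points of R^d, d >= 1, are column vectors: d is written n.+1. *)
Definition enorm (R : realType) (n : nat) (x : 'cV[R]_n.+1) : R :=
  Num.sqrt (\sum_i x i 0 ^+ 2).

(* The library has Lebesgue measure on R only. On R^d it is built here as the
   Caratheodory measure of the Lebesgue outer measure (infimum of the total
   volume of countable covers by boxes), so that the measurable sets are the
   Lebesgue measurable ones and the measure is complete. *)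
Section lebesgue_outer.
Local Open Scope ereal_scope.
Context {R : realType} {n : nat}.
Local Notation V := 'cV[R]_n.+1.
Implicit Types (c : V * V) (X : set V) (F : nat -> V * V).

Definition box c : set V :=
  [set x | forall i, (c.1 i 0 < x i 0 <= c.2 i 0)%R].

Definition box_volume c : \bar R := (\prod_i (c.2 i 0 - c.1 i 0)%R)%:E.

Definition box_cover X : set (nat -> V * V) :=
  [set F : nat -> V * V | (forall k i, (F k).1 i 0 <= (F k).2 i 0)%R /\
           X `<=` \bigcup_k box (F k)].

Definition lebesgue_outer X : \bar R :=
  ereal_inf [set \sum_(k <oo) box_volume (F k) | F in box_cover X].

Let box_volume_ge0 c :
  (forall i, c.1 i 0 <= c.2 i 0)%R -> 0 <= box_volume c.
Proof. by move=> h; rewrite lee_fin prodr_ge0// => i _; rewrite subr_ge0. Qed.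

Let lebesgue_outer_ge0 X : 0 <= lebesgue_outer X.
Proof.
apply: le_ereal_inf_tmp => _ [F [hF _] <-].
by apply: nneseries_ge0 => k _ _; exact: box_volume_ge0 (hF k).
Qed.

Let lebesgue_outer0 : lebesgue_outer set0 = 0.
Proof.
apply/eqP; rewrite eq_le lebesgue_outer_ge0 andbT.
apply: ereal_inf_lbound; exists (fun=> (0%R, 0%R)).
  by split => [k i|x//]; rewrite lexx.
rewrite eseries0// => k _ _; rewrite /box_volume /=.
by rewrite big_ord_recl subrr mul0r.
Qed.

Let le_lebesgue_outer : {homo lebesgue_outer : X Y / X `<=` Y >-> X <= Y}.
Proof.
move=> X Y XY; apply: ereal_inf_le_tmp => x [F [hF YF] <-].
by exists F => //; split => //; apply: subset_trans YF.
Qed.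

Let lebesgue_outer_sigma_subadditive : sigma_subadditive lebesgue_outer.
Proof.
move=> A; have [[i ioo]|] := pselect (exists i, lebesgue_outer (A i) = +oo).
  rewrite (eseries_pinfty _ _ ioo) ?leey// => k _.
  by rewrite -ltNye (lt_le_trans _ (lebesgue_outer_ge0 _)).
rewrite -forallNE => Aoo.
suff add2e (e : {posnum R}) : lebesgue_outer (\bigcup_k A k) <=
    \sum_(i <oo) lebesgue_outer (A i) + e%:num%:E.
  by apply/lee_addgt0Pr => _/posnumP[].
rewrite (le_trans _ (epsilon_trick _ _ _))//.
pose P k F := box_cover (A k) F /\ \sum_(j <oo) box_volume (F j) <=
  lebesgue_outer (A k) + (e%:num / (2 ^ k.+1)%:R)%:E.
have [G PG] : {G : nat -> nat -> V * V & forall k, P k (G k)}.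
  apply: (@choice _ _ P) => k; rewrite /P /lebesgue_outer.
  set S := (X in ereal_inf X); move infS : (ereal_inf S) => iS.
  case: iS infS => [r Sr|Soo|Soo].
  - have en1 : (0 < e%:num / (2 ^ k.+1)%:R)%R by [].
    have /(lb_ereal_inf_adherent en1) : ereal_inf S \is a fin_num by rewrite Sr.
    move=> [x [F cF <-] xS].
    by exists F; split => //; rewrite -Sr; exact/ltW.
  - by have := Aoo k; rewrite /lebesgue_outer Soo.
  - by have := lebesgue_outer_ge0 (A k); rewrite /lebesgue_outer -/S Soo.
have G_ge0 i j : 0 <= box_volume (G i j).
  by apply: box_volume_ge0; exact: (PG i).1.1.
apply: (@le_trans _ _ (\sum_(i <oo) \sum_(j <oo) box_volume (G i j))); last first.
  apply: lee_nneseries => i _; last exact: (PG i).2.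
  by move=> _; apply: nneseries_ge0 => j _ _; exact: G_ge0.
have /card_esym/ppcard_eqP[f] := card_nat2.
pose H := fun k => G (f k).1 (f k).2.
apply: (@le_trans _ _ (\sum_(k <oo) box_volume (H k))).
  apply: ereal_inf_lbound; exists H => //; split => [k i|x [i _ Aix]].
    exact: (PG (f k).1).1.1.
  have [j _ Gx] := (PG i).1.2 x Aix.
  by exists (f^-1%FUN (i, j)) => //; rewrite /H invK ?inE.
rewrite [leRHS](_ : _ = \esum_(i in setT) \esum_(j in setT) box_volume (G i j)).
  rewrite esum_esum => [|i j _ _]; last exact: G_ge0.
  rewrite nneseries_esumT => [|k]; last exact: G_ge0.
  rewrite (reindex_esum setT (setT `*`` (fun=> setT)) f)//.
  by split => // -[i j] _; exists (f^-1%FUN (i, j)) => //; rewrite invK ?inE.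
rewrite nneseries_esumT => [|k]; last first.
  by apply: nneseries_ge0 => j _ _; exact: G_ge0.
by apply: eq_esum => i _; rewrite nneseries_esumT// => k; exact: G_ge0.
Qed.

HB.instance Definition _ := isOuterMeasure.Build R V lebesgue_outer
  lebesgue_outer0 lebesgue_outer_ge0 le_lebesgue_outer
  lebesgue_outer_sigma_subadditive.

End lebesgue_outer.

Definition lebT (R : realType) (n : nat) :=
  caratheodory_type (@lebesgue_outer R n).

HB.instance Definition _ (R : realType) (n : nat) := Measurable.on (lebT R n).

Definition lebesgue (R : realType) (n : nat) : set (lebT R n) -> \bar R :=
  lebesgue_outer.

HB.instance Definition _ (R : realType) (n : nat) :=
  isMeasure.Build _ _ _ (@lebesgue R n)
    (@caratheodory_measure0 _ _ (@lebesgue_outer R n))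
    (@caratheodory_measure_ge0 _ _ (@lebesgue_outer R n))
    (@caratheodory_measure_sigma_additive _ _ (@lebesgue_outer R n)).

Arguments lebesgue {R n}.

Section dilations.
Context {R : realType} {n : nat}.
Implicit Types (A P : 'M[R]_n.+1) (k : int).

Definition dilation A : Prop :=
  forall z : R[i], eigenvalue (map_mx (real_complex R) A) z -> 1 < `|z|.

Definition ellipsoid P : set 'cV[R]_n.+1 := [set x | enorm (P *m x) < 1].

Definition dball A P k : set 'cV[R]_n.+1 := mulmx (A ^ k) @` ellipsoid P.

Definition annulus A P k : set 'cV[R]_n.+1 := dball A P k `\` dball A P (k - 1).

End dilations.

Section variable_exponents.
Context {R : realType} {n : nat}.
Local Notation V := 'cV[R]_n.+1.
Implicit Types (q f g : V -> R) (D E : set V).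

Definition measurable_on D f : Prop :=
  measurable_fun (D : set (lebT R n)) (f : lebT R n -> R).

Definition exponent q : Prop :=
  [/\ measurable_on setT q, forall x, 1 <= q x,
      (1 < ess_inf (@lebesgue R n) (fun x => (q x)%:E))%E &
      (ess_sup (@lebesgue R n) (fun x => (q x)%:E) < +oo)%E].

Definition Lq_norm D q f : \bar R :=
  ereal_inf [set l%:E | l in [set l : R | 0 < l /\
    (\int[@lebesgue R n]_(x in D) ((`|f x| / l) `^ q x)%:E <= 1)%E]].

Definition in_Lq D q f : Prop :=
  measurable_on D f /\ (Lq_norm D q f < +oo)%E.

Definition in_Lq_loc D q f : Prop :=
  forall E, compact E -> E `<=` D -> in_Lq E q f.

(* At x = 0 the convention 0^-1 = 0 replaces 1/log(e + oo) = 0 by 1/log e = 1;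
   this is harmless since the left-hand side vanishes there. *)
Definition log_holder_origin g : Prop :=
  exists2 C : R, 0 < C &
    forall x, `|g x - g 0| <= C / ln (expR 1 + (enorm x)^-1).

Definition log_holder_infinity g (goo : R) : Prop :=
  exists2 C : R, 0 < C &
    forall x, `|g x - goo| <= C / ln (expR 1 + enorm x).

End variable_exponents.

Section grand_herz.
Context {R : realType} {n : nat}.
Local Notation V := 'cV[R]_n.+1.
Implicit Types (A P : 'M[R]_n.+1) (alpha q f a : V -> R) (p theta : R).

Definition grand_norm p theta (u : int -> \bar R) : \bar R :=
  ereal_sup [set ((eps `^ theta)%:E *
      \esum_(k in [set: int]) u k `^ (p * (1 + eps))) `^ ((p * (1 + eps))^-1)
    | eps in [set eps : R | (0 < eps)%R]]%E.

Definition herz_norm A P alpha p q theta f : \bar R :=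
  grand_norm p theta (fun k => Lq_norm setT q (fun x =>
    `|\det A| `^ (k%:~R * alpha x) * f x * \1_(annulus A P k) x)).

Definition in_grand_herz A P alpha p q theta f : Prop :=
  in_Lq_loc (~` [set 0]) q f /\ (herz_norm A P alpha p q theta f < +oo)%E.

Definition alpha_at alpha (aoo : R) (l : int) : R :=
  if (l < 0)%R then alpha 0 else aoo.

Definition closed_support a : set V := closure [set x | a x != 0].

Definition central_block A P alpha (aoo : R) q (l : int) a : Prop :=
  [/\ measurable_on setT a, closed_support a `<=` dball A P l &
      (Lq_norm setT q a <= (`|\det A| `^ (- (l%:~R * alpha_at alpha aoo l)))%:E)%E].

End grand_herz.

Definition bilateral_sum (R : realType) (u : int -> R) (s : R) : Prop :=
  exists s1 s2 : R,
    [/\ series (fun k : nat => u k%:Z) @ \oo --> s1,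
        series (fun k : nat => u (- k.+1%:Z)) @ \oo --> s2 & s = s1 + s2].

(* Main.v *)
Require Import Defs.
From HB Require Import structures.
From mathcomp Require Import all_boot all_order all_algebra.
From mathcomp Require Import complex.
From mathcomp Require Import all_classical all_reals all_analysis.
From mathcomp Require Import ess_sup_inf.
From mathcomp Require Import measurable_realfun.
From mathcomp Require Import ring lra.

Set Implicit Arguments.
Unset Strict Implicit.
Unset Printing Implicit Defensive.

Import Order.TTheory GRing.Theory Num.Theory.
Import numFieldNormedType.Exports.

Local Open Scope classical_set_scope.
Local Open Scope ring_scope.

(** The theorem is an atomic decomposition in which the pieces are cut out by
    the annuli C_k = B_k \ B_{k-1}.  Two facts about the geometry drive it:
    the gauge x |-> |P x| grows by a factor at least r under A, and
    b = |det A| > 1.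

    By the growth of the gauge, on C_k the length |x| is at most a constant
    times r^k when k < 0 and at least a constant times r^k when k > 0; with
    log-Hoelder continuity at the origin and at infinity this bounds
    |k (alpha(x) - alpha_k)| on C_k uniformly in k ([log_holder_annulus]).
    Hence b^(k alpha(x)) may be replaced by the constant b^(k alpha_k) on C_k at
    the price of a constant factor ([weight_annulus]).

    From the space to the blocks, f is the sum of its pieces on the annuli, and
    the piece on C_{k-1}, suitably normalized, is a block for B_k, because the
    closure of B_{k-1} lies in B_k.  The coefficients are dominated by the terms
    of the Herz norm.

    From the blocks to the space, only the blocks of index l >= k contribute
    outside B_{k-1}, so that the norm of the weighted piece of f on C_k is at
    most a constant times the sum over l >= k of
    b^(k alpha_k - l alpha_l) |lambda_l| ([Lq_norm_weighted_piece_le],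
    [weighted_tail_mass]).  Since alpha(0) and alpha_oo are positive, this
    kernel decays geometrically in l - k ([weight_decay]), and the Schur test
    ([esum_schur]) gives an l^s bound with a constant independent of s >= 1.
    That uniformity is what lets the bound pass to the supremum over eps
    defining the grand norm ([le_grand_norm]).

    Countable sums in the variable exponent space are controlled at the level
    of the modular: pointwise Jensen's inequality with exponent q(x), followed
    by integration term by term ([modular_esum_le1]).  The same Jensen
    inequality ([esum_powR_jensen]) underlies the Schur test. *)

(** * Borel sets for the Lebesgue measure on R^d *)

Section lebesgue_borel.
Context {R : realType} {n : nat}.
Local Notation V := 'cV[R]_n.+1.
Local Notation mu := (@lebesgue R n).

(** The vector b with its i-th coordinate replaced by m. *)
Definition set_coord (b : V) (i : 'I_n.+1) (m : R) : V :=
  \col_j (if j == i then m else b j 0).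

(** A box cut by the hyperplane x_i = c is covered by two boxes whose volumes add
    up to its own. *)
Lemma caratheodory_halfspace (i : 'I_n.+1) (c : R) :
  (@lebesgue_outer R n).-caratheodory [set x : V | x i 0 <= c].
Proof.
apply: le_caratheodory_measurable => X /=.
set H := [set x : V | x i 0 <= c].
apply: le_ereal_inf_tmp => _ [F [hF XF] <-].
(* c clipped to the i-th side of the k-th box, so that a box lying on one side
   of the hyperplane is split into itself and a degenerate box *)
pose m k := Num.max ((F k).1 i 0) (Num.min ((F k).2 i 0) c).
have mge k : (F k).1 i 0 <= m k by rewrite le_max lexx.
have mle k : m k <= (F k).2 i 0 by rewrite ge_max hF ge_min lexx.
pose F1 k := ((F k).1, set_coord (F k).2 i (m k)).
pose F2 k := (set_coord (F k).1 i (m k), (F k).2).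
have hF1 k j : (F1 k).1 j 0 <= (F1 k).2 j 0.
  by rewrite /F1 /= mxE; case: ifP => [/eqP ->//|_]; exact: hF.
have hF2 k j : (F2 k).1 j 0 <= (F2 k).2 j 0.
  by rewrite /F2 /= mxE; case: ifP => [/eqP ->//|_]; exact: hF.
have vol0 (G : nat -> V * V) : (forall k j, (G k).1 j 0 <= (G k).2 j 0) ->
    forall k, (0 <= box_volume (G k))%E.
  by move=> h k; rewrite lee_fin prodr_ge0// => j _; rewrite subr_ge0.
have -> : (\sum_(k <oo) box_volume (F k) =
    \sum_(k <oo) box_volume (F1 k) + \sum_(k <oo) box_volume (F2 k))%E.
  rewrite -nneseriesD; [|by move=> k _ _; exact: vol0..].
  apply: eq_eseriesr => k _; rewrite /box_volume -EFinD; congr EFin.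
  rewrite (bigD1 i)//= [in RHS](bigD1 i)//= [X in _ = _ + X](bigD1 i)//=.
  rewrite !mxE eqxx.
  under [X in _ = _ * X + _]eq_bigr => j /negPf ji do rewrite mxE ji.
  under [X in _ = _ + _ * X]eq_bigr => j /negPf ji do rewrite mxE ji.
  ring.
apply: leeD; apply: ereal_inf_lbound.
- exists F1 => //; split => // x [Xx Hx].
  have [k _ Fx] := XF x Xx; exists k => // j.
  move: (Fx j) => /= /andP[-> xj] /=; rewrite mxE; case: eqP => [ji|_]//.
  subst j; rewrite /m le_max le_min xj.
  by rewrite (Hx : x i 0 <= c) orbT.
- exists F2 => //; split => // x [Xx Hx].
  have [k _ Fx] := XF x Xx; exists k => // j.
  move: (Fx j) => /= /andP[xj ->] /=; rewrite mxE andbT; case: eqP => [ji|_]//.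
  subst j; rewrite /m gt_max xj gt_min (ltNge c).
  have -> : ~~ (x i 0 <= c) by exact/negP.
  by rewrite orbT.
Qed.

Lemma measurable_coord (i : 'I_n.+1) :
  measurable_on setT (fun x : V => x i 0).
Proof.
move=> mT; apply: (measurability _ (measurable_realfun.RGenOInfty.measurableE R)) => //.
move=> _ [_ [a ->] <-]; rewrite setTI.
rewrite (_ : _ @^-1` _ = ~` [set x : lebT R n | (x : V) i 0 <= a]).
  by apply: measurableC; exact: caratheodory_halfspace.
apply/seteqP; split => x /=; rewrite in_itv/= andbT; first by move=> h; apply/negP; rewrite -ltNge.
by move/negP; rewrite -ltNge.
Qed.

(** The open box with corners a and b, as opposed to the half-open [box]. *)
Definition open_box (a b : V) : set V := [set x | forall i, a i 0 < x i 0 < b i 0].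

Lemma measurable_open_box (a b : V) : measurable (open_box a b : set (lebT R n)).
Proof.
rewrite (_ : open_box a b = \bigcap_(i in [set: 'I_n.+1])
   ((fun x : lebT R n => (x : V) i 0) @^-1` `]a i 0, b i 0[%classic)).
  apply: fin_bigcap_measurable => [|i _]; first exact: finite_finset.
  by rewrite -[_ @^-1` _]setTI; apply: measurable_coord.
apply/seteqP; split => x /= h i; first by move=> _; rewrite /= in_itv/= h.
by have := h i I; rewrite /= in_itv.
Qed.

(** An open set is the union of the open boxes with rational corners that it
    contains. *)
Lemma open_measurable_lebT (U : set V) : open U -> measurable (U : set (lebT R n)).
Proof.
move=> oU.
pose q2v (a : 'cV[rat]_n.+1) : V := map_mx ratr a.
pose F (ab : 'cV[rat]_n.+1 * 'cV[rat]_n.+1) : set (lebT R n) :=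
  if `[< open_box (q2v ab.1) (q2v ab.2) `<=` U >] then open_box (q2v ab.1) (q2v ab.2)
  else set0.
rewrite (_ : U = \bigcup_ab F ab).
  apply: countable_bigcupT_measurable => [|ab]; first exact: countableP.
  by rewrite /F; case: asboolP => // _; exact: measurable_open_box.
apply/seteqP; split => [x Ux|x [ab _]]; last first.
  by rewrite /F; case: asboolP => // h; exact: h.
have /nbhs_ballP[e /= e0 eU] : nbhs x U by exact: open_nbhs_nbhs.
have lo i : exists a : rat, x i 0 - e < ratr a < x i 0.
  have [|a] := @rat_in_itvoo R (x i 0 - e) (x i 0); first by rewrite ltrBlDr ltrDl.
  by rewrite in_itv => ?; exists a.
have hi i : exists a : rat, x i 0 < ratr a < x i 0 + e.
  have [|a] := @rat_in_itvoo R (x i 0) (x i 0 + e); first by rewrite ltrDl.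
  by rewrite in_itv => ?; exists a.
have {lo}[a ha] := choice lo; have {hi}[b hb] := choice hi.
have ab : open_box (q2v (\col_i a i)) (q2v (\col_i b i)) `<=` U.
  move=> y yab; apply: eU; split => // i j; rewrite (ord1 j) /ball /= ltr_distlC.
  have := yab i; rewrite !mxE => /andP[ay yb].
  have /andP[ha1 _] := ha i; have /andP[_ hb1] := hb i.
  by rewrite (lt_trans ha1 ay) (lt_trans yb hb1).
exists (\col_i a i, \col_i b i) => //; rewrite /F /=; case: asboolP => // _.
move=> i; rewrite !mxE.
by have /andP[_ ->] := ha i; have /andP[-> _] := hb i.
Qed.

Lemma closed_measurable_lebT (U : set V) :
  closed U -> measurable (U : set (lebT R n)).
Proof.
by move=> cU; rewrite -[U]setCK; apply: measurableC; apply: open_measurable_lebT;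
  exact: closed_openC.
Qed.

Lemma lebesgue_origin : mu [set (0 : V)] = 0%E.
Proof.
apply/eqP; rewrite eq_le measure_ge0 andbT; apply/lee_addgt0Pr => e e0; rewrite add0e.
(* as d <= 1, the cube of side d has volume at most d *)
pose d := Num.min 1 e.
have d0 : 0 < d by rewrite lt_min e0 ltr01.
pose F k : V * V := if k is 0%N then (const_mx (- d), 0) else (0, 0).
apply: (@le_trans _ _ (\sum_(k <oo) box_volume (F k))%E).
  apply: ereal_inf_lbound; exists F => //; split => [[|k] i /=|x ->].
  - by rewrite !mxE oppr_le0 ltW.
  - by [].
  - by exists 0%N => // i /=; rewrite !mxE lexx andbT oppr_lt0.
rewrite (nneseries_split 0 1); last first.
  move=> [|k] _; rewrite lee_fin prodr_ge0// => i _ /=.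
    by rewrite !mxE sub0r opprK ltW.
  by rewrite subrr.
rewrite eseries0 => [|[|k]// _ _]; last first.
  by rewrite /box_volume /= big_ord_recl subrr mul0r.
rewrite adde0 big_nat1 /box_volume /= lee_fin.
under eq_bigr do rewrite !mxE sub0r opprK.
rewrite prodr_const card_ord exprS.
have dn : d ^+ n <= 1 by rewrite exprn_ile1 ?(ltW d0)// ge_min lexx.
rewrite (le_trans (ler_piMr (ltW d0) dn))// ge_min lexx orbT//.
Qed.

End lebesgue_borel.

(** * Jensen's inequality, sums over the integers and the grand norm *)

Section jensen.
Context {R : realType}.
Implicit Types (s t m : R).

(** The graph of t |-> t^s lies above its tangent at m; a form of Young's
    inequality with conjugate exponents s and s / (s - 1). *)
Lemma powR_tangent t m s : 0 <= t -> 0 <= m -> 1 <= s ->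
  s * m `^ (s - 1) * t <= t `^ s + (s - 1) * m `^ s.
Proof.
move=> t0 m0; rewrite le_eqVlt => /predU1P[<-|s1].
  by rewrite subrr powRr0 powRr1// mul0r addr0 !mul1r.
have s0 : 0 < s by exact: lt_trans s1.
have s10 : 0 < s - 1 by rewrite subr_gt0.
have q0 : 0 < s / (s - 1) by rewrite divr_gt0.
have := conjugate_powR t0 (powR_ge0 m (s - 1)) s0 q0.
rewrite -powRrM mulrCA divff ?gt_eqF// mulr1 invf_div.
have -> : s^-1 + (s - 1) / s = 1 by field; rewrite gt_eqF.
move=> /(_ erefl) h.
have -> : s * m `^ (s - 1) * t = s * (t * m `^ (s - 1)) by ring.
have -> : t `^ s + (s - 1) * m `^ s = s * (t `^ s / s + m `^ s * ((s - 1) / s)).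
  by field; rewrite gt_eqF.
by rewrite ler_pM2l.
Qed.

(** Jensen's inequality for weights of total mass at most 1, obtained by summing
    the tangent inequality at the weighted mean. *)
Lemma sum_powR_jensen (I : Type) (r : seq I) (w x : I -> R) s : 1 <= s ->
  (forall i, 0 <= w i) -> (forall i, 0 <= x i) -> \sum_(i <- r) w i <= 1 ->
  (\sum_(i <- r) w i * x i) `^ s <= \sum_(i <- r) w i * x i `^ s.
Proof.
move=> s1 w0 x0 w1; set m := (X in X `^ s <= _).
have m0 : 0 <= m by apply: sumr_ge0 => i _; rewrite mulr_ge0.
have s0 : 0 < s by exact: lt_le_trans s1.
have : \sum_(i <- r) w i * (s * m `^ (s - 1) * x i) <=
       \sum_(i <- r) w i * (x i `^ s + (s - 1) * m `^ s).
  by apply: ler_sum => i _; rewrite ler_wpM2l// powR_tangent.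
have -> : \sum_(i <- r) w i * (s * m `^ (s - 1) * x i) = s * m `^ s.
  have -> : m `^ s = (\sum_(i <- r) w i * x i) * m `^ (s - 1).
    by rewrite -(mulr_powRB1 m0 s0).
  rewrite mulr_suml mulr_sumr.
  by apply: eq_bigr => i _; rewrite -/m; ring.
have -> : \sum_(i <- r) w i * (x i `^ s + (s - 1) * m `^ s) =
    \sum_(i <- r) w i * x i `^ s + (\sum_(i <- r) w i) * ((s - 1) * m `^ s).
  by rewrite mulr_suml -big_split; apply: eq_bigr => i _ /=; ring.
have : (\sum_(i <- r) w i) * ((s - 1) * m `^ s) <= (s - 1) * m `^ s.
  by rewrite ler_piMl// mulr_ge0 ?powR_ge0// subr_ge0.
move: (_ `^ s) => M; lra.
Qed.

Lemma le_poweR (s : R) (x y : \bar R) : 0 <= s -> (0 <= x)%E -> (x <= y)%E ->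
  (x `^ s <= y `^ s)%E.
Proof.
move=> s0 x0 xy; apply: gt0_ler_poweR => //; rewrite in_itv/= leey andbT//.
exact: le_trans xy.
Qed.

Lemma poweRKV (s : R) (x : \bar R) : 0 < s -> (0 <= x)%E -> ((x `^ s^-1) `^ s = x)%E.
Proof. by move=> s0 x0; rewrite -poweRrM mulVf ?poweRe1// gt_eqF. Qed.

Lemma poweRVK (s : R) (x : \bar R) : 0 < s -> (0 <= x)%E -> ((x `^ s) `^ s^-1 = x)%E.
Proof. by move=> s0 x0; rewrite -poweRrM divff ?poweRe1// gt_eqF. Qed.

Lemma esum_powR_jensen (I : choiceType) (w x : I -> R) s : 1 <= s ->
  (forall i, 0 <= w i) -> (forall i, 0 <= x i) ->
  (\esum_(i in [set: I]) (w i)%:E <= 1)%E ->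
  ((\esum_(i in [set: I]) (w i * x i)%:E) `^ s <=
    \esum_(i in [set: I]) (w i * x i `^ s)%:E)%E.
Proof.
move=> s1 w0 x0 w1; have s0 : 0 < s by exact: lt_le_trans s1.
have wx0 i : 0 <= w i * x i `^ s by rewrite mulr_ge0// powR_ge0.
set T := (X in (_ <= X)%E).
have T0 : (0 <= T)%E by apply: esum_ge0 => i _; rewrite lee_fin.
rewrite -[leRHS](poweRKV s0 T0); apply: le_poweR; first exact: ltW.
  by apply: esum_ge0 => i _; rewrite lee_fin mulr_ge0.
apply: ge_ereal_sup => _ [F [finF _] <-].
rewrite fsbig_finite//= sumEFin -[leLHS](@poweRVK s)//; last first.
  by rewrite lee_fin sumr_ge0// => i _; rewrite mulr_ge0.
apply: le_poweR; first by rewrite invr_ge0 ltW.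
  exact: poweR_ge0.
rewrite poweR_EFin (@le_trans _ _ (\sum_(i <- finmap.enum_fset (fset_set F)) w i * x i `^ s)%:E)//.
  rewrite lee_fin; apply: sum_powR_jensen => //.
  rewrite -lee_fin -sumEFin; apply: le_trans w1; apply: ereal_sup_ubound.
  by exists F; [split|rewrite fsbig_finite].
rewrite -sumEFin; apply: ereal_sup_ubound.
by exists F; [split|rewrite fsbig_finite].
Qed.

End jensen.

Section esum_int.
Context {R : realType}.
Local Open Scope ereal_scope.
Implicit Types (F : int -> \bar R).

Lemma esum_nneg_int F : (forall k, 0 <= F k) ->
  \esum_(k in [set k : int | (0 <= k)%R]) F k = \sum_(j <oo) F j%:Z.
Proof.
move=> F0; rewrite nneseries_esumT// (@reindex_esum _ _ _ setT _ (fun j : nat => j%:Z))//.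
by split => [j _//|i j _ _ /= [->]//|[j|j] //= _]; exists j.
Qed.

Lemma esum_int_addl F (k : int) :
  \esum_(l in [set: int]) F l = \esum_(l in [set: int]) F (k + l)%R.
Proof.
apply: (@reindex_esum _ _ _ setT _ (fun l => k + l)%R).
by split => // [i j _ _ /addrI//|l _]; exists (l - k)%R => //; rewrite addrC subrK.
Qed.

Lemma esum_intN F :
  \esum_(l in [set: int]) F l = \esum_(l in [set: int]) F (- l)%R.
Proof.
apply: (@reindex_esum _ _ _ setT _ (fun l => - l)%R).
by split => // [i j _ _ /oppr_inj//|l _]; exists (- l)%R => //; rewrite opprK.
Qed.

Lemma esum_int F : (forall k, 0 <= F k) -> \esum_(k in [set: int]) F k =
  \sum_(j <oo) F j%:Z + \sum_(j <oo) F (- j.+1%:Z)%R.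
Proof.
move=> F0; rewrite (esumID [set k : int | (0 <= k)%R])//.
rewrite !setTI esum_nneg_int//; congr (_ + _).
rewrite nneseries_esumT => [|//].
rewrite (@reindex_esum _ _ _ setT _ (fun j : nat => - j.+1%:Z)%R)//.
split => [j _ //|i j _ _ /= /oppr_inj[->]//|[j|j] //= h]; last by exists j.
Qed.

(** A sum over the integers whose terms vanish below k is a series over the
    naturals; likewise, in [esum_upto], for terms vanishing above k. *)
Lemma esum_from F k : (forall l, 0 <= F l) -> (forall l, (l < k)%R -> F l = 0) ->
  \esum_(l in [set: int]) F l = \sum_(j <oo) F (k + j%:Z)%R.
Proof.
move=> F0 Fk; rewrite (esum_int_addl _ k) esum_int//.
rewrite [X in _ + X]eseries0 ?adde0// => j _ _; apply: Fk.
by rewrite gtrDl oppr_lt0.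
Qed.

Lemma esum_upto F k : (forall l, 0 <= F l) -> (forall l, (k < l)%R -> F l = 0) ->
  \esum_(l in [set: int]) F l = \sum_(j <oo) F (k - j%:Z)%R.
Proof.
move=> F0 Fk; rewrite esum_intN (@esum_from _ (- k)%R)//.
  by apply: eq_eseriesr => j _; rewrite opprD opprK.
by move=> l lk; apply: Fk; rewrite ltrNr.
Qed.

Lemma esum_intZl F (r : R) : (forall k, 0 <= F k) -> (0 <= r)%R ->
  \esum_(k in [set: int]) (r%:E * F k) = r%:E * \esum_(k in [set: int]) F k.
Proof.
move=> F0 r0; rewrite !esum_int// => [|k]; last by rewrite mule_ge0.
by rewrite !nneseriesZl// muleDr// ge0_adde_def// inE nneseries_ge0.
Qed.

Lemma esum_exchange (I J : choiceType) (a : I -> J -> \bar R) :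
  (forall i j, 0 <= a i j) ->
  \esum_(i in [set: I]) \esum_(j in [set: J]) a i j =
  \esum_(j in [set: J]) \esum_(i in [set: I]) a i j.
Proof.
move=> a0; rewrite !esum_esum//.
rewrite (@reindex_esum _ _ _ (setT `*`` (fun=> setT)) _ (fun x : J * I => (x.2, x.1)))//.
by split => // [[i j] [k l] _ _ /= [-> ->]//|[i j] _]; exists (j, i).
Qed.

(** Schur test: if all row and column sums of the kernel c are at most S, then c
    is bounded on l^s with norm at most S, for every s >= 1. *)
Lemma esum_schur (c : int -> int -> R) (v : int -> R) (S s : R) :
  (0 < S)%R -> (1 <= s)%R -> (forall k l, (0 <= c k l)%R) ->
  (forall l, (0 <= v l)%R) ->
  (forall k, \esum_(l in [set: int]) (c k l)%:E <= S%:E) ->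
  (forall l, \esum_(k in [set: int]) (c k l)%:E <= S%:E) ->
  \esum_(k in [set: int]) (\esum_(l in [set: int]) (c k l * v l)%:E) `^ s <=
  (S `^ s)%:E * \esum_(l in [set: int]) (v l `^ s)%:E.
Proof.
move=> S0 s1 c0 v0 cl ck.
have Si0 : (0 <= S^-1)%R by rewrite invr_ge0 ltW.
have normalized (F : int -> R) : (forall k, (0 <= F k)%R) ->
    \esum_(k in [set: int]) (F k)%:E <= S%:E ->
    \esum_(k in [set: int]) (S^-1 * F k)%:E <= 1.
  move=> F0 FS; under eq_esum do rewrite EFinM.
  rewrite esum_intZl//.
  have -> : 1 = (S^-1)%:E * S%:E :> \bar R by rewrite -EFinM mulVf// gt_eqF.
  by rewrite lee_wpmul2l ?lee_fin.
(* each row divided by S is a family of weights of mass at most 1 *)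
have step k : (\esum_(l in [set: int]) (c k l * v l)%:E) `^ s <=
    (S `^ s)%:E * \esum_(l in [set: int]) (S^-1 * c k l * v l `^ s)%:E.
  have -> : \esum_(l in [set: int]) (c k l * v l)%:E =
      S%:E * \esum_(l in [set: int]) (S^-1 * c k l * v l)%:E.
    rewrite -esum_intZl ?(ltW S0)// => [|l]; last by rewrite lee_fin !mulr_ge0.
    by apply: eq_esum => l _; rewrite -EFinM// !mulrA divff ?gt_eqF// mul1r.
  rewrite poweRM ?lee_fin ?(ltW S0)//; last first.
    by apply: esum_ge0 => l _; rewrite lee_fin !mulr_ge0.
  rewrite poweR_EFin lee_wpmul2l ?lee_fin ?powR_ge0//.
  by apply: esum_powR_jensen => // [l|]; [rewrite mulr_ge0|exact: normalized].
apply: (@le_trans _ _ (\esum_(k in [set: int]) ((S `^ s)%:E *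
    \esum_(l in [set: int]) (S^-1 * c k l * v l `^ s)%:E))).
  by apply: le_esum => k _; exact: step.
rewrite esum_intZl ?powR_ge0// => [|k]; last first.
  by apply: esum_ge0 => l _; rewrite lee_fin !mulr_ge0// powR_ge0.
rewrite lee_wpmul2l ?lee_fin ?powR_ge0// esum_exchange => [|k l]; last first.
  by rewrite lee_fin !mulr_ge0// powR_ge0.
apply: le_esum => l _.
under eq_esum do rewrite mulrC EFinM.
rewrite esum_intZl ?powR_ge0// => [|k]; last by rewrite lee_fin mulr_ge0.
rewrite -[leRHS]mule1 lee_wpmul2l ?lee_fin ?powR_ge0//.
exact: normalized.
Qed.

Lemma nneseries_geometric (z : R) : (0 <= z < 1)%R ->
  \sum_(j <oo) (z ^+ j)%:E = ((1 - z)^-1)%:E.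
Proof.
move=> /andP[z0 z1].
have h := @cvg_geometric_series R 1%R z; rewrite ger0_norm// in h.
have {}h := h z1; rewrite mul1r in h.
apply/cvg_lim => //.
rewrite (_ : (fun n => _) = EFin \o series (geometric 1%R z)).
  by apply: cvg_comp h _.
apply/funext => n /=; rewrite -sumEFin; apply: eq_bigr => j _.
by rewrite /geometric /= mul1r.
Qed.

End esum_int.

Section grand_norm.
Context {R : realType}.
Implicit Types (u v : int -> \bar R).

(** An l^s bound whose constant K does not depend on s >= 1 carries over to the
    grand norm, all of whose exponents p (1 + eps) are at least 1. *)
Lemma le_grand_norm (p theta K : R) u v : 1 <= p -> 0 < K ->
  (forall s, 1 <= s -> (\esum_(k in [set: int]) u k `^ s <=
     (K `^ s)%:E * \esum_(k in [set: int]) v k `^ s)%E) ->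
  (grand_norm p theta u <= K%:E * grand_norm p theta v)%E.
Proof.
move=> p1 K0 uv; apply: ge_ereal_sup => _ [eps /= eps0 <-].
set s := p * (1 + eps).
have s1 : 1 <= s by rewrite /s mulr_ege1// ltW// ltrDl.
have s0 : 0 < s by exact: lt_le_trans s1.
have e0 : (0 <= (eps `^ theta)%:E :> \bar R)%E by rewrite lee_fin powR_ge0.
have es0 (w : int -> \bar R) : (0 <= \esum_(k in [set: int]) w k `^ s)%E.
  by apply: esum_ge0 => k _; exact: poweR_ge0.
apply: (@le_trans _ _ (K%:E * ((eps `^ theta)%:E *
    \esum_(k in [set: int]) v k `^ s) `^ s^-1)%E).
  rewrite -[K%:E](@poweRVK _ s) ?lee_fin ?(ltW K0)//.
  rewrite -poweRM ?poweR_ge0 ?mule_ge0//; apply: le_poweR => //.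
  - by rewrite invr_ge0 ltW.
  - by rewrite mule_ge0.
  - by rewrite poweR_EFin muleCA lee_wpmul2l// uv.
rewrite lee_wpmul2l ?lee_fin ?(ltW K0)//; apply: ereal_sup_ubound.
by exists eps.
Qed.

(** A finite grand norm makes a single l^s norm finite: take eps = 1. *)
Lemma grand_norm_esum_lty (p theta : R) u : 1 <= p ->
  (grand_norm p theta u < +oo)%E ->
  exists2 s, 1 <= s & (\esum_(k in [set: int]) u k `^ s < +oo)%E.
Proof.
move=> p1 h; exists (p * 2); first by rewrite mulr_ege1// ler1n.
have : ((\esum_(k in [set: int]) u k `^ (p * 2)) `^ (p * 2)^-1 < +oo)%E.
  apply: le_lt_trans h; apply: ereal_sup_ubound => /=.
  by exists 1 => //=; rewrite powR1 mul1e.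
apply: lty_poweRy; rewrite invr_eq0 mulf_neq0// gt_eqF//.
exact: lt_le_trans p1.
Qed.

Lemma esum_poweR_lty u s : 0 < s -> (forall k, (0 <= u k)%E) ->
  (\esum_(k in [set: int]) u k `^ s < +oo)%E -> forall k, (u k < +oo)%E.
Proof.
move=> s0 u0 h k; apply: (@lty_poweRy _ _ s); first by rewrite gt_eqF.
apply: le_lt_trans h; rewrite -(@esum_set1 _ _ k (fun k => u k `^ s)%E) ?poweR_ge0//.
rewrite [leRHS](esumID [set k])//; last by move=> i _; exact: poweR_ge0.
by rewrite setTI leeDl// esum_ge0// => i _; exact: poweR_ge0.
Qed.

End grand_norm.

Section bilateral.
Context {R : realType}.
Implicit Types (u : int -> R).

Lemma normr_series_le (u : nat -> R) (s : R) : series u @ \oo --> s ->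
  ((`|s|)%:E <= \sum_(j <oo) (`|u j|)%:E)%E.
Proof.
move=> us; set T := (X in (_ <= X)%E).
have T0 : (0 <= T)%E by exact: nneseries_ge0.
have bnd m : ((`|series u m|)%:E <= T)%E.
  apply: (@le_trans _ _ (\sum_(0 <= j < m) (`|u j|)%:E)%E).
    by rewrite sumEFin lee_fin /series/= ler_norm_sum.
  exact: nneseries_lim_ge.
case: T T0 bnd => [T| |]//=; last by move=> *; exact: leey.
move=> _ bnd; rewrite lee_fin.
have h : `|series u m| @[m --> \oo] --> `|s| by exact: cvg_norm us.
rewrite -(cvg_lim _ h)//; apply: limr_le; first by apply/cvg_ex; exists `|s|.
by apply: nearW => m; rewrite -lee_fin.
Qed.

Lemma normr_bilateral_sum_le u s : bilateral_sum u s ->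
  ((`|s|)%:E <= \esum_(k in [set: int]) (`|u k|)%:E)%E.
Proof.
move=> [s1 [s2 [h1 h2 ->]]]; rewrite esum_int//.
apply: (@le_trans _ _ ((`|s1|)%:E + (`|s2|)%:E)%E).
  by rewrite -EFinD lee_fin ler_normD.
apply: leeD.
  exact: normr_series_le h1.
exact: normr_series_le h2.
Qed.

Lemma cvg_series_single (u : nat -> R) (m : nat) :
  (forall j, j != m -> u j = 0) -> series u @ \oo --> u m.
Proof.
move=> um; apply: (@cvg_near_cst _ _ _ _ _ _); near=> k.
rewrite /series /=; have mk : (m < k)%N by near: k; exact: nbhs_infty_gt.
rewrite (bigD1_seq m) ?mem_index_iota ?iota_uniq//=.
by rewrite big1 ?addr0// => j /um.
Unshelve. all: by end_near. Qed.

Lemma cvg_series0 (u : nat -> R) : (forall j, u j = 0) -> series u @ \oo --> 0.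
Proof. by move=> u0; rewrite -(u0 0%N); apply: cvg_series_single => j _. Qed.

Lemma bilateral_sum_single u (m : int) :
  (forall k, k != m -> u k = 0) -> bilateral_sum u (u m).
Proof.
case: m => m um.
  exists (u m%:Z), 0; split; last by rewrite addr0.
    by apply: (@cvg_series_single (fun k : nat => u k%:Z)) => j jm; apply: um.
  by apply: cvg_series0 => j; apply: um.
exists 0, (u (Negz m)); split; last by rewrite add0r.
  by apply: cvg_series0 => j; apply: um.
rewrite NegzE.
by apply: (@cvg_series_single (fun k : nat => u (- k.+1%:Z))) => j jm; apply: um; rewrite NegzE eqr_opp.
Qed.

End bilateral.

(** * Measurability and the modular of the variable exponent space *)

Section measurability.
Context {R : realType} {n : nat}.
Local Notation V := 'cV[R]_n.+1.
Local Notation mu := (@lebesgue R n).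
Implicit Types (f g q : V -> R) (D N : set V).

Lemma negligible_measurable N : mu.-negligible (N : set (lebT R n)) ->
  measurable (N : set (lebT R n)).
Proof. exact: measure_is_complete_caratheodory. Qed.

Lemma ae_mono (S T : V -> Prop) : (forall x, S x -> T x) ->
  (\forall x \ae mu, S x) -> \forall x \ae mu, T x.
Proof.
move=> ST; apply: negligibleS => x /= nT Sx; exact/nT/ST.
Qed.

Lemma ae_and (S T : V -> Prop) : (\forall x \ae mu, S x) ->
  (\forall x \ae mu, T x) -> \forall x \ae mu, S x /\ T x.
Proof.
move=> hS hT; have := negligibleU hS hT.
apply: negligibleS => x /= /not_andP; rewrite /setU /=.
by case=> h; [left|right].
Qed.

Lemma measurable_on_negligible N f : mu.-negligible (N : set (lebT R n)) ->
  measurable_on N f.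
Proof.
move=> N0 _ Y mY; apply: negligible_measurable.
by apply: negligibleS N0; exact: subIsetl.
Qed.

(** As the measure is complete, an almost everywhere limit of measurable
    functions is measurable, whatever its values on the exceptional set. *)
Lemma measurable_ae_cvg (h : nat -> V -> R) f :
  (forall m, measurable_on setT (h m)) ->
  (\forall x \ae mu, h ^~ x @ \oo --> f x) -> measurable_on setT f.
Proof.
move=> mh hf; set N : set (lebT R n) := ~` [set x | h ^~ x @ \oo --> f x].
have N0 : mu.-negligible N by exact: hf.
have mN := negligible_measurable N0.
rewrite /measurable_on -(setvU N); apply/measurable_funU => //.
  exact: measurableC.
split; last exact: measurable_on_negligible.
apply: (@measurable_fun_cvg _ (lebT R n) R _ (h : nat -> lebT R n -> R)) => [m|x]; last by rewrite /N setCK.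
exact: measurable_funTS (mh m).
Qed.

Lemma trmx_cV_continuous : continuous (fun v : 'rV[R]_n.+1 => v^T : V).
Proof.
move=> v A /nbhs_ballP[e /= e0 eA]; apply/nbhs_ballP; exists e => //= w [_ vw].
by apply: eA; split => // i j; rewrite !mxE; exact: vw.
Qed.

Lemma cube_compact (M : R) :
  compact [set x : V | forall i, x i 0 \in `[- M, M]].
Proof.
rewrite (_ : [set x : V | _] = (fun v : 'rV[R]_n.+1 => v^T : V) @`
    [set v : 'rV[R]_n.+1 | forall i, v ord0 i \in `[- M, M]]).
  apply: continuous_compact.
    by apply: continuous_subspaceT => v; exact: trmx_cV_continuous.
  apply: (@rV_compact _ _ (fun=> `[- M, M]%classic)).
  by move=> _; exact: segment_compact.
apply/seteqP; split => [x h|_ [v h <-] i /=]; last by rewrite mxE.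
by exists x^T; rewrite ?trmxK// => i; rewrite mxE; exact: h.
Qed.

Lemma norm_coord_le (x : V) i : `|x i 0| <= `|x|.
Proof. by rewrite [leRHS]/Num.norm /= mx_normrE; apply: le_trans (le_bigmax _ _ (i, 0)). Qed.

(** The complement of the origin is a countable union of compact sets, and any
    function is measurable on the remaining point. *)
Lemma measurable_off_origin f :
  (forall E : set V, compact E -> E `<=` ~` [set 0] -> measurable_on E f) ->
  measurable_on setT f.
Proof.
move=> mf; pose K m := [set x : V | forall i, x i 0 \in `[- m%:R, m%:R]].
pose E m := [set x : V | m.+1%:R^-1 <= `|x|] `&` K m.
have clo m : closed [set x : V | m.+1%:R^-1 <= `|x|].
  rewrite (_ : [set x : V | _] = Num.norm @^-1` [set y | m.+1%:R^-1 <= y])//.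
  apply: closed_comp => [x _|]; first exact: norm_continuous.
  exact: closed_ge.
have cE m : compact (E m).
  apply: (subclosed_compact _ (@cube_compact m%:R)); last exact: subIsetr.
  apply: closedI => //; apply: compact_closed; first exact: norm_hausdorff.
  exact: cube_compact.
have mE m : measurable (E m : set (lebT R n)).
  apply: closed_measurable_lebT; apply: compact_closed (cE m).
  exact: norm_hausdorff.
have c0 : closed [set (0 : V)].
  by apply: compact_closed; [exact: norm_hausdorff|exact: compact_set1].
have -> : [set: lebT R n] = [set (0 : V)] `|` \bigcup_m E m.
  apply/esym/seteqP; split => // x _.
  have [->|x0] := eqVneq (x : V) 0; [by left|right].
  have nx : 0 < `|x : V| by rewrite normr_gt0.
  pose a := Num.trunc `|x : V|^-1; pose b := Num.trunc `|x : V|.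
  exists (maxn a b.+1) => //; split.
    rewrite /= invf_ple ?posrE//.
    apply: (le_trans (ltW (truncnS_gt _))); rewrite ler_nat ltnS leq_maxl//.
  move=> i; rewrite in_itv/= -ler_norml (le_trans (norm_coord_le _ _))//.
  by apply: (le_trans (ltW (truncnS_gt _))); rewrite ler_nat leq_maxr.
apply/measurable_funU.
- exact: closed_measurable_lebT.
- by apply: bigcupT_measurable.
split; first exact: measurable_fun_set1.
apply/measurable_fun_bigcup => // m; apply: mf => // x [/= h _] x0.
by move: h; rewrite x0 normr0 leNgt invr_gt0 ltr0n.
Qed.

(** The base 0 is treated apart: a power with nonzero exponent vanishes there,
    and elsewhere it is an exponential. *)
Lemma measurable_fun_powR2 D f q : measurable_on setT f -> measurable_on setT q ->
  (forall x, q x != 0) -> measurable_on D (fun x => f x `^ q x).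
Proof.
move=> mf mq q0; apply: measurable_funTS.
rewrite (_ : (fun x => _) = fun x : lebT R n =>
   if f x == 0 then 0 else expR (q x * ln (f x))); last first.
  by apply/funext => x; rewrite /powR (negPf (q0 _)).
have mlog : measurable_on setT (fun x => expR (q x * ln (f x))).
  apply: (@measurableT_comp _ _ _ _ _ _ (@expR R)); first exact: measurable_expR.
  apply: measurable_funM mq _.
  by apply: (@measurableT_comp _ _ _ _ _ _ (@ln R)); [exact: measurable_ln|exact: mf].
apply: (@measurable_fun_if _ _ (lebT R n) R (fun=> 0)
  (fun x => expR (q x * ln (f x))) setT measurableT (fun x => f x == 0)).
- by apply: measurable_fun_eqr; [exact: mf|exact: measurable_cst].
- exact: measurable_cst.
- exact: measurable_funTS mlog.
Qed.

End measurability.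

Section modular.
Context {R : realType} {n : nat}.
Local Notation V := 'cV[R]_n.+1.
Local Notation mu := (@lebesgue R n).
Implicit Types (f g q : V -> R) (D : set V).

(** The modular of g over D, the integral of g(x)^q(x); it is meant for
    nonnegative g. *)
Definition modular D q g : \bar R := (\int[mu]_(x in D) (g x `^ q x)%:E)%E.

(** Together with [modular_le1], this turns a bound on the Luxemburg norm into a
    bound by 1 on the modular of the rescaled function, up to strictness. *)
Lemma Lq_norm_le D q f (l : R) : 0 < l ->
  (modular D q (fun x => (`|f x| / l)%R) <= 1)%E -> (Lq_norm D q f <= l%:E)%E.
Proof. by move=> l0 h; apply: ereal_inf_lbound; exists l. Qed.

Section with_exponent.
Variables (D : set V) (q : V -> R).
Hypothesis mD : measurable (D : set (lebT R n)).
Hypothesis mq : measurable_on setT q.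
Hypothesis q1 : forall x, 1 <= q x.

Let q0 x : 0 < q x. Proof. exact: lt_le_trans (q1 x). Qed.

Lemma measurable_modular g : measurable_on setT g ->
  measurable_fun (D : set (lebT R n)) (fun x : lebT R n => (g x `^ q x)%:E).
Proof.
move=> mg; apply/measurable_EFinP; apply: measurable_fun_powR2 => // x.
by rewrite gt_eqF.
Qed.

Lemma le_modular g h : measurable_on setT g -> measurable_on setT h ->
  (forall x, 0 <= g x) -> (forall x, D x -> g x <= h x) ->
  (modular D q g <= modular D q h)%E.
Proof.
move=> mg mh g0 gh; apply: ge0_le_integral; first exact: mD.
- by move=> x _; rewrite lee_fin powR_ge0.
- exact: measurable_modular.
- exact: measurable_modular.
- move=> x Dx; rewrite lee_fin ge0_ler_powR ?nnegrE ?(ltW (q0 _))//.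
    exact: le_trans (gh _ Dx).
  exact: gh.
Qed.

Lemma measurable_normZ f (l : R) : measurable_on setT f ->
  measurable_on setT (fun x => `|f x| / l).
Proof.
move=> mf; apply: measurable_funM; last exact: measurable_cst.
by apply: (@measurableT_comp _ _ _ _ _ _ (@Num.norm R R)); [exact: normr_measurable|exact: mf].
Qed.

Lemma modular_le1 f (l : R) : measurable_on setT f ->
  (Lq_norm D q f < l%:E)%E -> (modular D q (fun x => (`|f x| / l)%R) <= 1)%E.
Proof.
move=> mf /ereal_inf_lt[_ [k [k0 hk] <-]]; rewrite lte_fin => kl.
have l0 := lt_trans k0 kl.
apply: le_trans hk; apply: le_modular => //.
- exact: measurable_normZ.
- exact: measurable_normZ.
- by move=> x; rewrite divr_ge0// ltW.
- by move=> x _; rewrite ler_wpM2l// lef_pV2 ?posrE// ltW.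
Qed.

Lemma Lq_norm_ge0 f : (0 <= Lq_norm D q f)%E.
Proof.
by apply: le_ereal_inf_tmp => _ [k [k0 _] <-]; rewrite lee_fin ltW.
Qed.

(** For 0 < l <= 1, (t / l)^q(x) is at least t^q(x) / l since q(x) >= 1; so
    a vanishing norm forces the modular of |f| to be at most every such l. *)
Lemma Lq_norm_eq0 f : measurable_on setT f -> Lq_norm D q f = 0%E ->
  \forall x \ae mu, D x -> f x = 0.
Proof.
move=> mf f0.
have mnf : measurable_on setT (fun x => `|f x|).
  by apply: (@measurableT_comp _ _ _ _ _ _ (@Num.norm R R)); [exact: normr_measurable|exact: mf].
have small l : 0 < l -> l <= 1 -> (modular D q (fun x => `|f x|%R) <= l%:E)%E.
  move=> l0 l1; have : (Lq_norm D q f < l%:E)%E by rewrite f0 lte_fin.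
  move/(modular_le1 mf) => h.
  have : (l%:E * modular D q (fun x => (`|f x| / l)%R) <= l%:E)%E.
    by rewrite -[leRHS]mule1 lee_wpmul2l// lee_fin ltW.
  apply: le_trans.
  rewrite /modular -ge0_integralZl_EFin; last 4 first.
  - exact: mD.
  - by move=> x _; rewrite lee_fin powR_ge0.
  - by apply: measurable_modular; exact: measurable_normZ.
  - exact: ltW.
  apply: ge0_le_integral; first exact: mD.
  - by move=> x _; rewrite lee_fin powR_ge0.
  - exact: measurable_modular.
  - by apply: measurable_funeM; apply: measurable_modular; exact: measurable_normZ.
  move=> x _; rewrite -EFinM lee_fin powRM ?invr_ge0 ?(ltW l0)//.
  rewrite mulrCA ler_peMr ?powR_ge0//.
  rewrite -[leLHS](@divff _ l) ?gt_eqF// ler_pM2l// le1r_powR//.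
  by rewrite invf_ge1.
have m0 : modular D q (fun x => `|f x|) = 0%E.
  apply/eqP; rewrite eq_le integral_ge0 ?andbT; last first.
    by move=> x _; rewrite lee_fin powR_ge0.
  apply/lee_addgt0Pr => e e0; rewrite add0e.
  have := small (Num.min 1 e); rewrite lt_min e0 ltr01 ge_min lexx => /(_ isT isT).
  by move/le_trans; apply; rewrite lee_fin ge_min lexx orbT.
have : ae_eq mu (D : set (lebT R n)) (fun x => (`|f x| `^ q x)%:E) (cst 0%E).
  apply/(@ae_eq_integral_abs _ (lebT R n) R mu D mD).
    exact: measurable_modular.
  rewrite -[RHS]m0; apply: eq_integral => x _.
  by rewrite gee0_abs// lee_fin powR_ge0.
apply: ae_mono => x /= h Dx; apply/eqP.
by have /eqP := h Dx; rewrite eqe powR_eq0 normr_eq0 => /andP[].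
Qed.

(** The unit ball of the modular is stable under countable combinations with
    weights of mass at most 1.  The weights vanish below some index k so that
    the sum may be integrated as a series over the naturals. *)
Lemma modular_esum_le1 (k : int) (w : int -> R) (t : int -> V -> R) g :
  (forall l, 0 <= w l) -> (forall l, l < k -> w l = 0) ->
  (\esum_(l in [set: int]) (w l)%:E <= 1)%E ->
  (forall l, measurable_on setT (t l)) -> (forall l x, 0 <= t l x) ->
  (forall l, modular D q (t l) <= 1)%E ->
  measurable_on setT g -> (forall x, 0 <= g x) ->
  (\forall x \ae mu, D x ->
    ((g x)%:E <= \esum_(l in [set: int]) (w l * t l x)%:E)%E) ->
  (modular D q g <= 1)%E.
Proof.
move=> w0 wk w1 mt t0 mt1 mg g0 gt.
pose F j x : \bar R := ((w (k + j%:Z))%:E * (t (k + j%:Z) x `^ q x)%:E)%E.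
have F0 j x : (0 <= F j x)%E by rewrite mule_ge0 ?lee_fin ?powR_ge0.
have mF j : measurable_fun (D : set (lebT R n)) (F j).
  by apply: measurable_funeM; exact: measurable_modular.
apply: (@le_trans _ _ (\int[mu]_(x in D) (\sum_(j <oo) F j x))%E).
  apply: (@ae_ge0_le_integral _ (lebT R n) R mu D mD).
  - by move=> x _; rewrite lee_fin powR_ge0.
  - exact: measurable_modular.
  - by move=> x _; exact: nneseries_ge0.
  - by apply: (@ge0_emeasurable_sum _ (lebT R n) R D F predT) => [j x _ _|j _];
      [exact: F0|exact: mF].
  apply: ae_mono gt => x gt Dx; have {}gt := gt Dx.
  rewrite -poweR_EFin; apply: (le_trans (le_poweR _ _ gt)).
  - exact: ltW.
  - by rewrite lee_fin.
  apply: (le_trans (esum_powR_jensen _ _ _ w1)) => //.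
  rewrite (@esum_from _ _ k) => [|l|l lk].
  - by apply: lee_nneseries => [j _|j _]; rewrite ?lee_fin ?mulr_ge0 ?powR_ge0// /F EFinM.
  - by rewrite lee_fin mulr_ge0 ?powR_ge0.
  - by rewrite wk// mul0r.
rewrite integral_nneseries//.
apply: le_trans w1; rewrite (@esum_from _ _ k) => [|l|l lk]; last 2 first.
- by rewrite lee_fin.
- by rewrite wk.
apply: lee_nneseries => [j _ _|j _].
  by apply: integral_ge0 => x _; exact: F0.
rewrite (@ge0_integralZl_EFin _ (lebT R n) R mu D mD); last 3 first.
- by move=> x _; rewrite lee_fin powR_ge0.
- exact: measurable_modular.
- exact: w0.
by rewrite -[leRHS]mule1; apply: lee_wpmul2l; [rewrite lee_fin|exact: mt1].
Qed.

End with_exponent.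
End modular.

(** * Linear maps, the determinant of a dilation and the balls *)

Section norms.
Context {R : realType} {n : nat}.
Local Notation V := 'cV[R]_n.+1.
Implicit Types (x y : V) (M : 'M[R]_n.+1).

Lemma enorm_ge0 x : 0 <= enorm x.
Proof. exact: sqrtr_ge0. Qed.

Lemma enormZ (a : R) x : enorm (a *: x) = `|a| * enorm x.
Proof.
rewrite /enorm; under eq_bigr do rewrite mxE exprMn.
by rewrite -mulr_sumr sqrtrM ?sqr_ge0// sqrtr_sqr.
Qed.

Lemma coord_le_enorm x i : `|x i 0| <= enorm x.
Proof.
rewrite -sqrtr_sqr ler_wsqrtr// (bigD1 i)//= lerDl.
by apply: sumr_ge0 => j _; exact: sqr_ge0.
Qed.

Lemma enorm_le_sum x : enorm x <= \sum_i `|x i 0|.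
Proof.
have s0 : 0 <= \sum_i `|x i 0| by exact: sumr_ge0.
rewrite -(ger0_norm s0) -sqrtr_sqr ler_wsqrtr// expr2 mulr_suml.
apply: ler_sum => i _; rewrite -real_normK ?num_real// expr2 ler_wpM2l//.
by rewrite (bigD1 i)//= lerDl; exact: sumr_ge0.
Qed.

Lemma enorm_eq0 x : enorm x = 0 -> x = 0.
Proof.
move=> x0; apply/matrixP => i j; rewrite (ord1 j) mxE.
by apply/eqP; rewrite -normr_le0 -x0 coord_le_enorm.
Qed.

Lemma enorm_mulmx_le M : exists2 c, 0 < c &
  forall x, enorm (M *m x) <= c * enorm x.
Proof.
exists (1 + \sum_i \sum_j `|M i j|).
  by rewrite ltr_pwDl//; apply: sumr_ge0 => i _; exact: sumr_ge0.
move=> x; apply: (le_trans (enorm_le_sum _)); rewrite mulrDl mul1r.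
apply: ler_wpDl; first exact: enorm_ge0.
rewrite mulr_suml; apply: ler_sum => i _; rewrite mxE mulr_suml.
apply: (le_trans (ler_norm_sum _ _ _)); apply: ler_sum => j _.
by rewrite normrM ler_wpM2l// coord_le_enorm.
Qed.

Lemma enorm_mulmx_continuous M : continuous (fun x => enorm (M *m x)).
Proof.
move=> x; apply: (@continuous_comp _ _ _ (fun x : V => \sum_i (M *m x) i 0 ^+ 2) Num.sqrt);
  last exact: sqrt_continuous.
apply: continuous_big => [|i _]; first exact: add_continuous.
move=> y; rewrite (_ : (fun x => _) = fun x : V =>
    (\sum_j M i j * x j 0) * (\sum_j M i j * x j 0)); last first.
  by apply/funext => z; rewrite mxE expr2.
have lin : continuous (fun x : V => \sum_j M i j * x j 0).
  apply: continuous_big => [|j _ z]; first exact: add_continuous.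
  apply: (@continuousM _ _ (fun=> M i j) (fun x : V => x j 0)).
    exact: cst_continuous.
  exact: coord_continuous.
by apply: continuousM; exact: lin.
Qed.

End norms.

Section determinant.

Lemma prodr_gt1 (F : numDomainType) (s : seq F) : s != [::] ->
  (forall z, z \in s -> 1 < `|z|) -> 1 < \prod_(z <- s) `|z|.
Proof.
elim: s => [//|z s IH] _ h; rewrite big_cons.
have z1 : 1 < `|z| by apply: h; rewrite mem_head.
have [->|s0] := eqVneq s [::]; first by rewrite big_nil mulr1.
rewrite mulr_egt1// IH// => y ys; apply: h; by rewrite inE ys orbT.
Qed.

(** The determinant is, up to sign, the product of the complex eigenvalues. *)
Lemma dilation_det_gt1 (R : realType) (n : nat) (A : 'M[R]_n.+1) :
  dilation A -> 1 < `|\det A|.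
Proof.
move=> hA; pose M := map_mx (real_complex R) A.
have [s hs] := closed_field_poly_normal (char_poly M).
have mon : lead_coef (char_poly M) = 1 by apply/monicP; exact: char_poly_monic.
rewrite mon scale1r in hs.
have ss : size s = n.+1.
  have := size_char_poly M; rewrite hs size_prod_XsubC => -[].
  by move=> h; exact: h.
have ev z : z \in s -> 1 < `|z|.
  by move=> zs; apply: hA; rewrite eigenvalue_root_char -/M hs root_prod_XsubC.
have : 1 < \prod_(z <- s) `|z| by apply: prodr_gt1 => //; rewrite -size_eq0 ss.
have -> : \prod_(z <- s) `|z| = `|\det M|.
  have := char_poly_det M; rewrite hs -horner_coef0 horner_prod => /(congr1 Num.norm).
  rewrite normrM normrX normrN1 expr1n mul1r normr_prod => <-.
  by apply: eq_bigr => z _; rewrite hornerXsubC sub0r normrN.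
rewrite det_map_mx normc_def/= expr0n addr0 sqrtr_sqr.
by rewrite (ltcR 1).
Qed.

End determinant.

Section gauge.
Context {R : realType} {n : nat}.
Local Notation V := 'cV[R]_n.+1.
Variables (A P : 'M[R]_n.+1) (r : R).
Hypotheses (uA : A \is a GRing.unit) (uP : P \in unitmx) (r1 : 1 < r).
Hypothesis rPA : *:%R r @` ellipsoid P `<=` mulmx A @` ellipsoid P.
Implicit Types (x : V) (k l : int).

Local Notation g x := (enorm (P *m x)).
Let r0 : 0 < r. Proof. exact: lt_trans r1. Qed.

Lemma mulmx_exprzD k l x : A ^ (k + l) *m x = A ^ k *m (A ^ l *m x).
Proof. by rewrite exprzDr// mulmxA. Qed.

(** The inclusion of r Delta in A Delta, restated for the gauge of Delta by
    homogeneity. *)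
Lemma gauge_expand x : r * g x <= g (A *m x).
Proof.
(* t > g (A x), so that A x / t lies in Delta *)
apply/ler_addgt0Pr => e e0; set t := g (A *m x) + e.
have t0 : 0 < t by rewrite ltr_wpDl// enorm_ge0.
have /rPA[y yP Ay] : ( *:%R r @` ellipsoid P) (r *: (t^-1 *: (A *m x))).
  exists (t^-1 *: (A *m x)) => //; rewrite /ellipsoid /= -scalemxAr enormZ.
  rewrite gtr0_norm ?invr_gt0// mulrC ltr_pdivrMr// mul1r /t ltrDl//.
have yE : y = (r / t) *: x.
  apply: (can_inj (mulKmx uA)); rewrite Ay -scalemxAr scalerA//.
move: yP; rewrite yE /ellipsoid /= -scalemxAr enormZ gtr0_norm ?divr_gt0//.
by rewrite mulrAC ltr_pdivrMr// mul1r => /ltW.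
Qed.

Lemma gauge_expandX (j : nat) k x :
  r ^+ j * g (A ^ k *m x) <= g (A ^ (k + j%:Z) *m x).
Proof.
elim: j => [|j IH]; first by rewrite expr0 mul1r addr0.
rewrite exprS -mulrA; apply: le_trans (_ : r * g (A ^ (k + j%:Z) *m x) <= _).
  by rewrite ler_pM2l.
apply: (le_trans (gauge_expand _)).
by rewrite intS addrCA (mulmx_exprzD 1) expr1z.
Qed.

(** Membership in B_k, expressed by the gauge of Delta pulled back by A^(-k). *)
Lemma dballE k : dball A P k = [set x | g (A ^ (- k) *m x) < 1].
Proof.
apply/seteqP; split => [_ [x xP <-]|x /= h].
  by rewrite /= -mulmx_exprzD addNr expr0z mul1mx.
exists (A ^ (- k) *m x) => //.
by rewrite -mulmx_exprzD addrN expr0z mul1mx.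
Qed.

Lemma open_dball k : open (dball A P k).
Proof.
rewrite dballE (_ : [set x | _] = (fun x => enorm ((P *m A ^ (- k)) *m x)) @^-1` [set y | y < 1]).
  apply: open_comp => [x _|]; last exact: open_lt.
  exact: enorm_mulmx_continuous.
by apply/seteqP; split => x /=; rewrite mulmxA.
Qed.

Lemma measurable_dball k : measurable (dball A P k : set (lebT R n)).
Proof. by apply: open_measurable_lebT; exact: open_dball. Qed.

Lemma measurable_annulus k : measurable (annulus A P k : set (lebT R n)).
Proof. by apply: measurableD; exact: measurable_dball. Qed.

Lemma dball_le k l : k <= l -> dball A P k `<=` dball A P l.
Proof.
move=> kl; rewrite !dballE => x /=; apply: le_lt_trans.
have [j lk] : exists j : nat, l - k = j%:Z.
  by exists `|l - k|%N; rewrite gez0_abs// subr_ge0.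
have := gauge_expandX j (- l) x.
have -> : - l + j%:Z = - k by rewrite -lk addrA addNr add0r.
by apply: le_trans; rewrite ler_peMl ?enorm_ge0// exprn_ege1// ltW.
Qed.

Lemma closure_dball k : closure (dball A P k) `<=` dball A P (k + 1).
Proof.
apply: (@subset_trans _ [set x | g (A ^ (- k) *m x) <= 1]).
  have cl : closed [set x | g (A ^ (- k) *m x) <= 1].
    rewrite (_ : [set x | _] =
        (fun x => enorm ((P *m A ^ (- k)) *m x)) @^-1` [set y | y <= 1]).
      apply: closed_comp => [x _|]; last exact: closed_le.
      exact: enorm_mulmx_continuous.
    by apply/seteqP; split => x /=; rewrite mulmxA.
  rewrite [X in _ `<=` X]((closure_id _).1 cl).
  by apply: closureS; rewrite dballE => x /= /ltW.
rewrite dballE => x /= x1.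
have := gauge_expandX 1 (- (k + 1)) x; rewrite expr1 opprD addrNK => h.
have {}h := le_trans h x1.
rewrite -(ltr_pM2l r0) mulr1; exact: le_lt_trans r1.
Qed.

(** By Bernoulli's inequality r^j >= 1 + j (r - 1). *)
Lemma exprn_unbounded (y : R) : exists j : nat, y < r ^+ j.
Proof.
have bern j : 1 + j%:R * (r - 1) <= r ^+ j.
  elim: j => [|j IH]; first by rewrite mul0r addr0 expr0.
  rewrite exprS; apply: le_trans (_ : r * (1 + j%:R * (r - 1)) <= _).
    rewrite -subr_ge0 (_ : _ - _ = j%:R * (r - 1) ^+ 2).
      by rewrite mulr_ge0// sqr_ge0.
    by rewrite -natr1; ring.
  by rewrite ler_pM2l.
have [j hj] : exists j : nat, y / (r - 1) < j%:R.
  by exists (Num.trunc (y / (r - 1))).+1; exact: truncnS_gt.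
exists j; apply: lt_le_trans (bern j).
rewrite ltr_pdivrMr ?subr_gt0// in hj.
by apply: lt_le_trans hj _; rewrite lerDr.
Qed.

Lemma gauge_eq0 x : g x = 0 -> x = 0.
Proof.
by move/enorm_eq0 => Px; rewrite -(mulKmx uP x) Px mulmx0.
Qed.

Lemma annulus_not_origin k : ~ annulus A P k 0.
Proof.
move=> [_]; apply; rewrite dballE /=.
by rewrite !mulmx0 -[0](scale0r (0 : V)) enormZ normr0 mul0r.
Qed.

Lemma notin_dball_near x : x != 0 -> exists j : nat, ~ dball A P (- j%:Z) x.
Proof.
move=> x0; have gx : 0 < g x.
  rewrite lt_neqAle enorm_ge0 andbT eq_sym; apply: contra x0 => /eqP/gauge_eq0 ->//.
have [j hj] := exprn_unbounded (g x)^-1; exists j.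
rewrite dballE /= opprK => h.
have := gauge_expandX j 0 x; rewrite expr0z mul1mx add0r => h2.
have := le_lt_trans h2 h; apply/negP; rewrite -leNgt.
by move: hj => /ltW; rewrite -(ler_pM2r gx) mulVf// gt_eqF.
Qed.

Lemma in_dball_far x : exists j : nat, dball A P j%:Z x.
Proof.
have [j hj] := exprn_unbounded (g x); exists j; rewrite dballE /=.
have := gauge_expandX j (- j%:Z) x; rewrite addNr expr0z mul1mx => h.
have rj : 0 < r ^+ j by rewrite exprn_gt0.
by rewrite -(ltr_pM2l rj) mulr1; exact: le_lt_trans hj.
Qed.

(** A nonzero point lies in B_k for large k but not for very negative k; the
    least k that works gives its annulus. *)
Lemma annulus_exists x : x != 0 -> exists k, annulus A P k x.
Proof.
move=> x0; have [i hi] := notin_dball_near x0; have [j hj] := in_dball_far x.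
pose p m := `[< dball A P (- i%:Z + m%:Z) x >].
have ex : exists m, p m.
  exists (i + j)%N; apply/asboolP; rewrite PoszD addrA addNr add0r//.
case: (ex_minnP ex) => -[|m] /asboolP pm minm.
  by move: pm; rewrite addr0 => /hi.
exists (- i%:Z + m.+1%:Z); split => // h.
have /minm : p m by apply/asboolP; move: h; rewrite intS [1 + _]addrC addrA addrK.
by rewrite ltnn.
Qed.

Lemma annulus_uniq x k l : annulus A P k x -> annulus A P l x -> k = l.
Proof.
have aux k' l' : annulus A P k' x -> annulus A P l' x -> k' <= l'.
  move=> [_ kx] [lx _]; rewrite leNgt; apply/negP => lk; apply: kx.
  by apply: dball_le lx; rewrite lerBrDr lezD1.
by move=> hk hl; apply/eqP; rewrite eq_le !aux.
Qed.

Lemma enorm_le_gauge : exists2 c, 1 <= c &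
  forall x, enorm x <= c * g x /\ g x <= c * enorm x.
Proof.
have [c c0 hc] := enorm_mulmx_le P; have [d d0 hd] := enorm_mulmx_le (invmx P).
exists (1 + c + d); first by rewrite -addrA lerDl addr_ge0// ltW.
move=> x; split.
  rewrite -{1}(mulKmx uP x); apply: (le_trans (hd _)).
  by rewrite ler_wpM2r ?enorm_ge0// lerDr addr_ge0// ltW.
apply: (le_trans (hc _)); rewrite ler_wpM2r ?enorm_ge0//.
by rewrite addrAC lerDr addr_ge0// ltW.
Qed.

(** The logarithm is at least 1 and at least ln y - ln c; one of the two bounds
    suffices according to whether ln y <= 1 + ln c or not. *)
Lemma ln_lower_bound (c y : R) : 1 <= c -> 1 <= y ->
  ln y / (1 + ln c) <= ln (expR 1 + y / c).
Proof.
move=> c1 y1; have c0 : 0 < c by exact: lt_le_trans c1.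
have y0 : 0 < y by exact: lt_le_trans y1.
have L0 : 0 <= ln c by rewrite ln_ge0.
have e0 : 0 < expR 1 :> R by exact: expR_gt0.
have yc0 : 0 < y / c by rewrite divr_gt0.
have h1 : 1 <= ln (expR 1 + y / c).
  by rewrite -{1}(expRK 1) ler_ln ?posrE ?addr_gt0// lerDl ltW.
have h2 : ln y - ln c <= ln (expR 1 + y / c).
  by rewrite -ln_div ?posrE// ler_ln ?posrE ?addr_gt0// lerDr ltW.
rewrite ler_pdivrMr; last by rewrite ltr_pwDl.
move: h1 h2 L0; set t := ln (_ + _); set a := ln y; set b := ln c => h1 h2 L0.
nra.
Qed.

(** On C_k the distance to the origin, or its inverse, is at least a constant
    times r^|k|, so the logarithm in the log-Hoelder condition is at least a
    constant times |k|. *)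
Lemma log_holder_annulus (alpha : V -> R) (aoo : R) :
  log_holder_origin alpha -> log_holder_infinity alpha aoo ->
  exists2 C, 0 <= C & forall k x, annulus A P k x ->
    `|k%:~R * (alpha x - alpha_at alpha aoo k)| <= C.
Proof.
move=> [C1 C10 h1] [C2 C20 h2]; have [c c1 hc] := enorm_le_gauge.
have c0 : 0 < c by exact: lt_le_trans c1.
have lr : 0 < ln r by rewrite ln_gt0.
(* the extra factor r compensates for C_k being known to avoid only B_{k-1} *)
pose d := r * c; have d1 : 1 <= d by rewrite /d mulr_ege1// ltW.
have d0 : 0 < d by exact: lt_le_trans d1.
pose K := (1 + ln d) / ln r.
have K0 : 0 < K by rewrite divr_gt0// ltr_pwDl// ln_ge0.
(* b stands for 1 / |x| near the origin and for |x| near infinity; a is the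
   oscillation of alpha, and j = |k| *)
have key (C a b : R) (j : nat) : 0 < C -> r ^+ j / d <= b ->
    a <= C / ln (expR 1 + b) -> j%:R * a <= C * K.
  move=> C0 hb ha; have rj : 1 <= r ^+ j by rewrite exprn_ege1// ltW.
  have [->|j0] := posnP j; first by rewrite mul0r mulr_ge0// ltW.
  have jr : 0 < j%:R :> R by rewrite ltr0n.
  have e0 : 0 < expR 1 :> R by exact: expR_gt0.
  have b0 : 0 < b by apply: lt_le_trans hb; rewrite divr_gt0// exprn_gt0.
  have := ln_lower_bound d1 rj; rewrite lnXn// -[ln r *+ j]mulr_natl => h.
  have {}h : j%:R * ln r / (1 + ln d) <= ln (expR 1 + b).
    apply: (le_trans h); rewrite ler_ln ?posrE ?addr_gt0 ?divr_gt0 ?exprn_gt0//.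
    by rewrite lerD2l.
  have p0 : 0 < j%:R * ln r / (1 + ln d).
    by rewrite divr_gt0 ?mulr_gt0// ltr_pwDl// ln_ge0.
  apply: (le_trans (ler_wpM2l (ltW jr) ha)).
  apply: (@le_trans _ _ (j%:R * (C / (j%:R * ln r / (1 + ln d))))).
    rewrite ler_wpM2l ?(ltW jr)// ler_wpM2l ?(ltW C0)// lef_pV2 ?posrE//.
    exact: lt_le_trans h.
  rewrite le_eqVlt; apply/orP; left; apply/eqP; rewrite /K.
  have : 1 + ln d != 0 by rewrite gt_eqF// ltr_pwDl// ln_ge0.
  move: (gt_eqF lr) (gt_eqF jr) => /negbT lr0 /negbT jr0 d'.
  by field; rewrite jr0 lr0 d'.
exists ((C1 + C2) * K); first by rewrite mulr_ge0 ?addr_ge0 ?ltW.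
have CK1 : C1 * K <= (C1 + C2) * K by rewrite ler_wpM2r ?lerDl ?(ltW K0) ?(ltW C20).
have CK2 : C2 * K <= (C1 + C2) * K by rewrite ler_wpM2r ?lerDr ?(ltW K0) ?(ltW C10).
move=> k x kx; have x0 : x != 0.
  by apply: contraPneq kx => ->; exact: annulus_not_origin.
have ex0 : 0 < enorm x.
  by rewrite lt_neqAle enorm_ge0 andbT eq_sym; apply: contra x0 => /eqP/enorm_eq0 ->.
rewrite normrM /alpha_at; case: k kx => [[|j]|j] kx /=.
- by rewrite normr0 mul0r mulr_ge0 ?addr_ge0 ?ltW.
- rewrite ger0_norm ?ler0n//.
  apply: le_trans CK2; apply: (key _ _ (enorm x)) => //.
  have [_] := kx; rewrite dballE /= => /negP; rewrite -leNgt => h.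
  have := gauge_expandX j (- j%:Z) x; rewrite addNr expr0z mul1mx.
  rewrite (_ : - (j.+1%:Z - 1) = - j%:Z) in h; last by rewrite intS addrAC subrr add0r.
  have [_ gc] := hc x => h3.
  rewrite ler_pdivrMr// /d exprS mulrCA ler_pM2l// mulrC.
  apply: le_trans gc; apply: le_trans h3.
  by rewrite ler_peMr// ltW// exprn_gt0.
- rewrite normrN ger0_norm ?ler0n//.
  apply: le_trans CK1; apply: (key _ _ (enorm x)^-1) => //.
  have [] := kx; rewrite dballE /= NegzE opprK => h _.
  have := gauge_expandX j.+1 0 x; rewrite expr0z mul1mx add0r => h3.
  have [gc _] := hc x.
  rewrite ler_pdivrMr// -[leRHS](mulrC d) ler_pdivlMr//.
  apply: (@le_trans _ _ (r ^+ j.+1 * (c * g x))).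
    by rewrite ler_wpM2l// exprn_ge0// ltW.
  rewrite mulrCA /d; apply: (@le_trans _ _ (c * 1)).
    by rewrite ler_pM2l// ltW// (le_lt_trans h3).
  by rewrite mulr1 ler_peMl// ltW.
Qed.

End gauge.

(** * Block decomposition and synthesis in the grand Herz space *)

Section blocks.
Context {R : realType} {n : nat}.
Local Notation V := 'cV[R]_n.+1.
Local Notation mu := (@lebesgue R n).
Implicit Types (f h q : V -> R) (D E : set V).

Lemma ae_forall_int (S : int -> V -> Prop) :
  (forall k, \forall x \ae mu, S k x) -> \forall x \ae mu, forall k, S k x.
Proof.
move=> hS.
have h1 := @ae_foralln _ (lebT R n) R mu (fun j : nat => S j%:Z) (fun j => hS _).
have h2 := @ae_foralln _ (lebT R n) R mu (fun j : nat => S (Negz j)) (fun j => hS _).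
by apply: ae_mono (ae_and h1 h2) => x [xp xn] [j|j]; [exact: xp|exact: xn].
Qed.

Lemma modular_indic D q h : measurable (D : set (lebT R n)) ->
  (forall x, 1 <= q x) ->
  modular setT q (fun x => h x * \1_D x) = modular D q h.
Proof.
move=> mD q1; rewrite /modular [RHS]integral_mkcond.
apply: eq_integral => x _; rewrite patchE indicE.
case: ifPn => xD; first by rewrite mulr1.
by rewrite mulr0 powR0// gt_eqF// (lt_le_trans _ (q1 x)).
Qed.

Lemma modular_subset D E q h : measurable (D : set (lebT R n)) ->
  measurable (E : set (lebT R n)) -> measurable_on setT q ->
  (forall x, 1 <= q x) -> measurable_on setT h -> E `<=` D ->
  (modular E q h <= modular D q h)%E.
Proof.
move=> mD mE mq q1 mh ED.
apply: (@ge0_subset_integral _ (lebT R n) R mu E D mE mD) ED.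
  exact: measurable_modular.
by move=> x _; rewrite lee_fin powR_ge0.
Qed.

End blocks.

Section herz.
Context {R : realType} {n : nat}.
Local Notation V := 'cV[R]_n.+1.
Local Notation mu := (@lebesgue R n).
Variables (A P : 'M[R]_n.+1) (r : R).
Hypotheses (b1 : 1 < `|\det A|) (uA : A \is a GRing.unit) (uP : P \in unitmx).
Hypotheses (r1 : 1 < r).
Hypothesis rPA : *:%R r @` ellipsoid P `<=` mulmx A @` ellipsoid P.
Variables (q alpha : V -> R) (aoo : R).
Hypotheses (mq : measurable_on setT q) (q1 : forall x, 1 <= q x).
Hypothesis malpha : measurable_on setT alpha.
Hypotheses (ha0 : 0 < alpha 0) (haoo : 0 < aoo).
Hypotheses (hor : log_holder_origin alpha) (hoo : log_holder_infinity alpha aoo).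

Local Notation b := (`|\det A|).
Local Notation al := (alpha_at alpha aoo).

Let b0 : 0 < b. Proof. exact: lt_trans b1. Qed.

(** On C_k the variable weight b^(k alpha(x)) is comparable to the constant
    b^(k alpha_k), uniformly in k. *)
Lemma weight_annulus : exists2 B, 1 <= B & forall k x, annulus A P k x ->
  b `^ (k%:~R * alpha x) <= B * b `^ (k%:~R * al k) /\
  b `^ (k%:~R * al k) <= B * b `^ (k%:~R * alpha x).
Proof.
have [C C0 hC] := log_holder_annulus uA uP r1 rPA hor hoo.
exists (b `^ C).
  by rewrite -(powRr0 b) ler_powR// ltW.
move=> k x /hC; rewrite mulrBr ler_norml => /andP[h1 h2].
rewrite -!powRD ?(gt_eqF b0) ?implybT// !ler_powR ?(ltW b1)//; first lra.
lra.
Qed.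

(** The function b^(k alpha) f chi_k whose norm is the k-th term of the Herz
    norm of f. *)
Definition weighted_piece f (k : int) (x : V) : R :=
  b `^ (k%:~R * alpha x) * f x * \1_(annulus A P k) x.

Lemma measurable_indic_lebT D : measurable (D : set (lebT R n)) ->
  measurable_on setT (\1_D : V -> R).
Proof. by move=> mD; exact: (@measurable_indic _ (lebT R n) R setT D mD). Qed.

Lemma measurable_weighted_piece f k : measurable_on setT f -> measurable_on setT (weighted_piece f k).
Proof.
move=> mf; apply: measurable_funM.
  apply: measurable_funM; last exact: mf.
  apply: (@measurableT_comp _ _ _ _ _ _ (@powR R b)).
    exact: measurable_powRr.
  by apply: measurable_funM; [exact: measurable_cst|exact: malpha].
by apply: measurable_indic_lebT; exact: measurable_annulus.
Qed.

Lemma grand_herz_block_decomposition (p theta : R) f : 1 <= p ->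
  in_grand_herz A P alpha p q theta f ->
  exists (lambda : int -> R) (a : int -> V -> R),
    [/\ \forall x \ae mu, bilateral_sum (fun k => lambda k * a k x) (f x),
        forall k, central_block A P alpha aoo q k (a k) &
        (grand_norm p theta (fun k => `|lambda k|%:E) < +oo)%E].
Proof.
move=> p1 [floc fnorm].
have mf : measurable_on setT f.
  by apply: measurable_off_origin => E cE E0; have [] := floc E cE E0.
have [B B1 hB] := weight_annulus.
have B0 : 0 < B by exact: lt_le_trans B1.
pose u k := Lq_norm setT q (weighted_piece f k).
have u0 k : (0 <= u k)%E by exact: Lq_norm_ge0.
have {}fnorm : (grand_norm p theta u < +oo)%E by exact: fnorm.
have uoo k : (u k < +oo)%E.
  have [s s1 us] := grand_norm_esum_lty p1 fnorm.
  exact: esum_poweR_lty (lt_le_trans ltr01 s1) u0 us k.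
pose v k := fine (u k).
have uE k : u k = (v k)%:E by rewrite fineK// ge0_fin_numE.
have v0 k : 0 <= v k by exact: fine_ge0.
(* the piece of f on C_{k-1} becomes the block of index k: its closed support
   lies in the closure of B_{k-1}, hence in the open set B_k, whereas the
   closure of C_k is not contained in B_k *)
pose W k : R := b `^ (k%:~R * al k).
have W0 k : 0 < W k by exact: powR_gt0.
(* the factor 2 gives a strict bound on the norm, hence a bound on the modular
   even if the infimum defining the norm is not attained; dividing by
   W (k - 1) removes the weight from that norm, at the price of the factor B,
   and W k normalizes the block of index k; when the piece has norm 0, lam k = 0 and the
   convention x / 0 = 0 makes a k the zero function *)
pose lam k : R := 2 * B * W k / W (k - 1) * v (k - 1).
pose a k x : R := f x * \1_(annulus A P (k - 1)) x / lam k.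
have ma k : measurable_on setT (a k).
  apply: measurable_funM; last exact: measurable_cst.
  apply: measurable_funM; first exact: mf.
  by apply: measurable_indic_lebT; exact: measurable_annulus.
exists lam, a; split.
- have fz k : \forall x \ae mu, v k = 0 -> annulus A P k x -> f x = 0.
    have [vk|vk] := eqVneq (v k) 0; last first.
      by apply: aeW => x vk0; rewrite vk0 eqxx in vk.
    have : u k = 0%E by rewrite uE vk.
    move=> /(Lq_norm_eq0 measurableT mq q1 (measurable_weighted_piece k mf)).
    apply: ae_mono => x /(_ I) /eqP hx _ kx; apply/eqP; move: hx.
    rewrite /weighted_piece indicE mem_set// mulr1 mulf_eq0 gt_eqF//.
    exact: powR_gt0.
  have x0 : \forall x \ae mu, x <> (0 : V).
    exists [set (0 : V)]; split; last by move=> x /= /contrapT.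
      apply: closed_measurable_lebT.
      by apply: compact_closed; [exact: norm_hausdorff|exact: compact_set1].
    exact: lebesgue_origin.
  apply: ae_mono (ae_and x0 (ae_forall_int fz)) => x [{}x0 hx].
  have [k kx] : exists k, annulus A P k x.
    by apply: (annulus_exists uA uP r1 rPA); exact/eqP.
  have one l : lam l * a l x = if l == k + 1 then f x else 0.
    rewrite /a indicE; case: eqP => [->|lk].
      rewrite /lam addrK mem_set// mulr1.
      have [vk|vk] := eqVneq (v k) 0; first by rewrite (hx k vk kx) mul0r mulr0.
      by rewrite mulrCA divff ?mulr1// !mulf_neq0// ?invr_neq0// gt_eqF.
    rewrite memNset ?mulr0 ?mul0r ?mulr0// => lx; apply: lk.
    by rewrite (annulus_uniq uA r1 rPA kx lx) subrK.
  have -> : f x = lam (k + 1) * a (k + 1) x by rewrite one eqxx.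
  apply: (@bilateral_sum_single _ (fun l => lam l * a l x)) => l lk.
  by rewrite one (negPf lk).
- move=> k; split; first exact: ma.
    apply: (@subset_trans _ (closure (dball A P (k - 1)))).
      apply: closureS => x /=; rewrite /a indicE; case: (boolP (x \in _)).
        by rewrite inE => -[].
      by rewrite mulr0 mul0r eqxx.
    by have := closure_dball uA r1 rPA (k := k - 1); rewrite subrK.
  rewrite powRN -/(W k); apply: Lq_norm_le; first by rewrite invr_gt0.
  have [vk|vk] := eqVneq (v (k - 1)) 0.
    rewrite (_ : (fun x => _) = fun x => 0 * \1_set0 x).
      rewrite modular_indic// /modular integral_set0//.
    apply/funext => x; rewrite /a /lam vk !mulr0 invr0 mulr0 normr0 mul0r.
    by rewrite mul0r.
  have vp : 0 < v (k - 1) by rewrite lt_neqAle eq_sym vk v0.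
  have lamp : 0 < lam k by rewrite /lam !mulr_gt0// ?invr_gt0.
  have : (Lq_norm setT q (weighted_piece f (k - 1)) < (2 * v (k - 1))%:E)%E.
    by rewrite -/(u _) uE lte_fin ltr_pMl// ltr1n.
  move=> /(modular_le1 measurableT mq q1 (measurable_weighted_piece (k - 1) mf)).
  apply: le_trans; apply: le_modular => //.
  + exact: measurable_normZ.
  + by apply: measurable_normZ; exact: measurable_weighted_piece.
  + by move=> x; rewrite divr_ge0// invr_ge0 ltW.
  move=> x _; rewrite /a /weighted_piece indicE; case: (boolP (x \in _)) => xk; last first.
    by rewrite !mulr0 mul0r normr0 !mul0r.
  rewrite !mulr1 invrK !normrM normfV (gtr0_norm lamp).
  rewrite (gtr0_norm (powR_gt0 ((k - 1)%:~R * alpha x) b0)).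
  have [_] := hB _ _ (set_mem xk); rewrite -/(W (k - 1)) => hW.
  have -> : `|f x| / lam k * W k = W (k - 1) / (2 * B * v (k - 1)) * `|f x|.
    rewrite /lam; move: (gt_eqF (W0 k)) (gt_eqF (W0 (k - 1))) (gt_eqF B0).
    move=> /negbT w1 /negbT w2 /negbT w3.
    by field; rewrite vk w1 w2 w3.
  rewrite [leRHS]mulrAC ler_wpM2r// ler_pdivrMr ?mulr_gt0//.
  rewrite (le_trans hW)// mulrAC mulrCA -mulrA.
  rewrite le_eqVlt; apply/orP; left; apply/eqP; field.
  by rewrite vk.
- (* the exponent k alpha_k - (k - 1) alpha_{k-1} is alpha(0) if k <= 0 and
     alpha_oo if k > 0 *)
  pose K : R := 2 * B * b `^ (alpha 0 + aoo).
  have K0 : 0 < K by rewrite !mulr_gt0// powR_gt0.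
  have hK k : W k / W (k - 1) <= b `^ (alpha 0 + aoo).
    rewrite /W -powRB ?(gt_eqF b0) ?implybT// ler_powR ?(ltW b1)//.
    have -> : k%:~R * al k - (k - 1)%:~R * al (k - 1) =
        if k <= 0 then alpha 0 else aoo.
      rewrite /alpha_at ltrBlDr add0r.
      have -> : (k < 1) = (k <= 0) by rewrite -ltzD1 add0r.
      rewrite rmorphB /=; case: ltgtP => k0.
      + ring.
      + ring.
      + by rewrite k0 /=; ring.
    by case: ifP => _; [rewrite lerDl|rewrite lerDr]; exact: ltW.
  apply: (@le_lt_trans _ _ (K%:E * grand_norm p theta u)%E); last first.
    apply: lte_mul_pinfty => //; rewrite lee_fin ltW//.
  apply: le_grand_norm => // s s1.
  have s0 : 0 <= s by exact: le_trans s1.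
  rewrite -esum_intZl ?powR_ge0//; last by move=> k; exact: poweR_ge0.
  rewrite [leLHS](esum_int_addl _ 1); apply: le_esum => k _.
  rewrite uE !poweR_EFin lee_fin -powRM ?(ltW K0)// ge0_ler_powR ?nnegrE//.
    by rewrite mulr_ge0// ltW.
  rewrite /lam addrAC subrr add0r ger0_norm; last first.
    by rewrite !mulr_ge0 ?invr_ge0 ?v0 ?(ltW B0) ?(ltW (W0 _)).
  rewrite ler_wpM2r// -mulrA ler_pM2l ?mulr_gt0//.
  by have := hK (1 + k); rewrite addrAC subrr add0r.
Qed.

Lemma dball_small e : 0 < e -> exists j : nat,
  forall x, dball A P (- j%:Z) x -> enorm x < e.
Proof.
move=> e0; have [c c1 hc] := enorm_le_gauge uP.
have c0 : 0 < c by exact: lt_le_trans c1.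
have [j hj] := exprn_unbounded r1 (c / e); exists j => x.
rewrite dballE//= opprK => h.
have := gauge_expandX uA r1 rPA j 0 x; rewrite expr0z mul1mx add0r => h2.
have rj : 0 < r ^+ j by rewrite exprn_gt0// (lt_trans _ r1).
have [hx _] := hc x; apply: (le_lt_trans hx).
have : r ^+ j * enorm (P *m x) < 1 by exact: le_lt_trans h.
rewrite mulrC -ltr_pdivlMr// div1r => h3.
apply: (@lt_trans _ _ (c / r ^+ j)); first by rewrite ltr_pM2l.
by rewrite ltr_pdivrMr// mulrC -ltr_pdivrMr.
Qed.

Lemma compact_off_dball E : compact E -> E `<=` ~` [set (0 : V)] ->
  exists k, E `<=` ~` dball A P (k - 1).
Proof.
move=> cE E0; have clE : closed E by apply: compact_closed cE; exact: norm_hausdorff.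
have : nbhs (0 : V) (~` E).
  apply: open_nbhs_nbhs; split; first exact: closed_openC.
  by move=> /E0; exact.
move=> /nbhs_ballP[e /= e0 he]; have [j hj] := dball_small e0.
exists (- j%:Z + 1) => x Ex; rewrite addrK => /hj xe.
apply: (he x) => //; split => // i k; rewrite (ord1 k) /ball /= mxE sub0r normrN.
exact: le_lt_trans (coord_le_enorm x i) xe.
Qed.

(** Each step of k alpha_k is alpha(0) or alpha_oo, hence at least their
    minimum. *)
Lemma weight_decay k l : k <= l ->
  k%:~R * al k - l%:~R * al l <= - ((l - k)%:~R * Num.min (alpha 0) aoo).
Proof.
move=> kl; set m := Num.min _ _.
have m0 : m <= alpha 0 by rewrite ge_min lexx.
have moo : m <= aoo by rewrite ge_min lexx orbT.
have klR : (k%:~R <= l%:~R :> R) by rewrite ler_int.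
rewrite rmorphB /= /alpha_at; case: (ltP k 0) => k0; case: (ltP l 0) => l0.
- have : (k%:~R <= 0 :> R) by rewrite (ler_int _ k 0) ltW.
  nra.
- have : (k%:~R <= 0 :> R) by rewrite (ler_int _ k 0) ltW.
  have : (0 <= l%:~R :> R) by rewrite (ler_int _ 0 l).
  nra.
- by have := le_lt_trans k0 (le_lt_trans kl l0); rewrite ltxx.
- nra.
Qed.

(** The kernel b^(k alpha_k - l alpha_l), set to 0 unless k <= l. *)
Definition decay (k l : int) : R :=
  if k <= l then b `^ (k%:~R * al k - l%:~R * al l) else 0.

Lemma decay_ge0 k l : 0 <= decay k l.
Proof. by rewrite /decay; case: ifP => // _; exact: powR_ge0. Qed.

(** Rows and columns of the kernel are dominated by the geometric series of
    ratio b^(- min(alpha(0), alpha_oo)). *)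
Lemma decay_summable : exists2 S, 0 < S &
  (forall k, \esum_(l in [set: int]) (decay k l)%:E <= S%:E)%E /\
  (forall l, \esum_(k in [set: int]) (decay k l)%:E <= S%:E)%E.
Proof.
pose m := Num.min (alpha 0) aoo.
have m0 : 0 < m by rewrite lt_min ha0.
pose z := b `^ (- m).
have z0 : 0 < z by exact: powR_gt0.
have z1 : z < 1.
  by rewrite /z powRN invf_lt1 ?powR_gt0// /powR (gt_eqF b0) -expR0 ltr_expR mulr_gt0// ln_gt0.
have z01 : 0 <= z < 1 by rewrite ltW.
have dz k (j : nat) : decay k (k + j%:Z) <= z ^+ j.
  rewrite /decay lerDl/= -powR_mulrn ?(ltW z0)// /z -powRrM.
  rewrite ler_powR ?(ltW b1)//.
  have := @weight_decay k (k + j%:Z); rewrite lerDl => /(_ isT).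
  have -> : k + j%:Z - k = j%:Z by rewrite addrAC subrr add0r.
  by rewrite mulNr [m * _]mulrC -/m pmulrn.
exists (1 - z)^-1; first by rewrite invr_gt0 subr_gt0.
have d0 k l : (0 <= (decay k l)%:E)%E by rewrite lee_fin decay_ge0.
split=> k; rewrite -(nneseries_geometric z01).
  rewrite (@esum_from _ _ k) => [|//|l lk]; last by rewrite /decay leNgt lk.
  by apply: lee_nneseries => // j _; rewrite lee_fin.
rewrite (@esum_upto _ _ k) => [|//|l lk]; last by rewrite /decay leNgt lk.
apply: lee_nneseries => // j _; rewrite lee_fin.
by have := dz (k - j%:Z) j; rewrite subrK.
Qed.

Section synthesis.
Variables (f : V -> R) (lam : int -> R) (a : int -> V -> R).
Hypothesis fa : \forall x \ae mu, bilateral_sum (fun k => lam k * a k x) (f x).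
Hypothesis blk : forall k, central_block A P alpha aoo q k (a k).

(* M l exceeds the norm of a l strictly, and T k bounds the norm of f outside
   B_{k-1}, the region D k *)
Let M l : R := 2 * b `^ (- (l%:~R * al l)).
Let M0 l : 0 < M l. Proof. by rewrite mulr_gt0// powR_gt0. Qed.
Let T k : \bar R :=
  (\esum_(l in [set: int]) (if k <= l then `|lam l| * M l else 0)%:E)%E.
Let D k : set V := ~` dball A P (k - 1).

Let mD k : measurable (D k : set (lebT R n)).
Proof. by apply: measurableC; exact: measurable_dball. Qed.

Lemma measurable_block_sum : measurable_on setT f.
Proof.
have mla k : measurable_on setT (fun x => lam k * a k x).
  by apply: measurable_funM; [exact: measurable_cst|have [] := blk k].
pose h1 m x := series (fun j : nat => lam j%:Z * a j%:Z x) m.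
pose h2 m x := series (fun j : nat => lam (- j.+1%:Z) * a (- j.+1%:Z) x) m.
apply: (@measurable_ae_cvg _ _ (fun m x => h1 m x + h2 m x)).
  move=> m; apply: measurable_funD.
    apply: (@measurable_sum _ (lebT R n) R setT nat _ (fun (j : nat) x => lam j%:Z * a j%:Z x)).
    by move=> j; exact: mla.
  apply: (@measurable_sum _ (lebT R n) R setT nat _
    (fun (j : nat) x => lam (- j.+1%:Z) * a (- j.+1%:Z) x)).
  by move=> j; exact: mla.
apply: ae_mono fa => x [s1 [s2 [c1 c2 ->]]].
exact: cvgD.
Qed.

(** Outside B_{k-1} only the blocks of index l >= k are nonzero. *)
Lemma modular_block_sum k S : 0 < S -> (T k <= S%:E)%E ->
  (modular (D k) q (fun x => (`|f x| / S)%R) <= 1)%E.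
Proof.
move=> S0 TS; have mf := measurable_block_sum.
have Si0 : 0 <= S^-1 by rewrite invr_ge0 ltW.
pose w l : R := S^-1 * (if k <= l then `|lam l| * M l else 0).
pose t l x : R := `|a l x| / M l.
have w0 l : 0 <= w l by rewrite mulr_ge0//; case: ifP => // _; rewrite mulr_ge0// ltW.
have mt l : measurable_on setT (t l) by apply: measurable_normZ; have [] := blk l.
have t0 l x : 0 <= t l x by rewrite divr_ge0// ltW.
apply: (@modular_esum_le1 _ _ (D k) q (mD k) mq q1 k w t).
- exact: w0.
- by move=> l lk; rewrite /w leNgt lk mulr0.
- rewrite /w; under eq_esum do rewrite EFinM.
  rewrite esum_intZl// => [|l]; last first.
    by rewrite lee_fin; case: ifP => // _; rewrite mulr_ge0// ltW.
  have -> : 1%E = ((S^-1)%:E * S%:E)%E :> \bar R by rewrite -EFinM mulVf// gt_eqF.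
  by rewrite lee_wpmul2l ?lee_fin.
- exact: mt.
- exact: t0.
- move=> l; apply: (@le_trans _ _ (modular setT q (t l))).
    by apply: modular_subset; [exact: measurableT|exact: mD|exact: mq|exact: q1|exact: mt|].
  have [mal _ nal] := blk l.
  apply: (modular_le1 measurableT mq q1 mal).
  by apply: le_lt_trans nal _; rewrite lte_fin /M ltr_pMl ?powR_gt0// ltr1n.
- exact: measurable_normZ.
- by move=> x; rewrite divr_ge0// ltW.
apply: ae_mono fa => x /normr_bilateral_sum_le fx Dx.
rewrite mulrC EFinM.
apply: (le_trans (lee_wpmul2l _ fx)); first by rewrite lee_fin.
rewrite -esum_intZl//; apply: le_esum => l _; rewrite -EFinM lee_fin.
rewrite /w /t -mulrA ler_wpM2l//; case: (leP k l) => kl.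
  rewrite normrM le_eqVlt; apply/orP; left; apply/eqP.
  by rewrite -mulrA [M l * _]mulrC divfK// gt_eqF.
have [_ sup _] := blk l.
have -> : a l x = 0; last by rewrite mulr0 normr0 mul0r.
apply/eqP/negPn/negP => ax; apply: Dx.
apply: (@dball_le _ _ A P r uA r1 rPA l); first by rewrite lerBrDr lezD1.
by apply: sup; exact: subset_closure.
Qed.

Lemma Lq_norm_weighted_piece_le k B : 1 <= B -> (forall x, annulus A P k x ->
    b `^ (k%:~R * alpha x) <= B * b `^ (k%:~R * al k)) ->
  (Lq_norm setT q (weighted_piece f k) <= (B * b `^ (k%:~R * al k))%:E * T k)%E.
Proof.
move=> B1 hB; have mf := measurable_block_sum.
set c := B * _; have c0 : 0 < c.
  by rewrite mulr_gt0 ?powR_gt0// (lt_le_trans _ B1).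
have T0 : (0 <= T k)%E.
  by apply: esum_ge0 => l _; rewrite lee_fin; case: ifP => // _; rewrite mulr_ge0// ltW.
have main S : 0 < S -> (T k <= S%:E)%E -> (Lq_norm setT q (weighted_piece f k) <= (c * S)%:E)%E.
  move=> S0 TS; apply: Lq_norm_le; first by rewrite mulr_gt0.
  apply: le_trans (modular_block_sum S0 TS).
  rewrite -(modular_indic _ (mD k) q1); apply: le_modular.
  - exact: measurableT.
  - exact: mq.
  - exact: q1.
  - by apply: measurable_normZ; exact: measurable_weighted_piece.
  - apply: measurable_funM; first exact: measurable_normZ.
    exact: measurable_indic_lebT.
  - by move=> x; rewrite divr_ge0// mulr_ge0// ltW.
  move=> x _; rewrite /weighted_piece !indicE; case: (boolP (x \in annulus A P k)) => xk.
    have [_ xk'] := set_mem xk.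
    rewrite (mem_set (xk' : D k x)) !mulr1 normrM (gtr0_norm (powR_gt0 _ b0)).
    rewrite invfM mulrA ler_wpM2r ?invr_ge0 ?(ltW S0)//.
    by rewrite mulrAC ler_piMl// ler_pdivrMr// mul1r hB// -inE.
  by rewrite mulr0 normr0 mul0r mulr_ge0 ?divr_ge0 ?(ltW S0)// ler0n.
case: (T k) T0 main => [t| |] // T0 main; last first.
  by rewrite gt0_muley ?leey// lte_fin.
apply/lee_addgt0Pr => e e0; rewrite -EFinM -EFinD.
(* T k itself may be 0, where [main] does not apply *)
have h : 0 < t + e / c by rewrite ltr_wpDl ?divr_gt0// -lee_fin.
apply: (le_trans (main _ h _)); first by rewrite lee_fin lerDl ltW// divr_gt0.
by rewrite mulrDr mulrCA divff ?mulr1// gt_eqF.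
Qed.

Lemma weighted_tail_mass k c : 0 <= c -> ((c * b `^ (k%:~R * al k))%:E * T k =
  \esum_(l in [set: int]) (2 * c * decay k l * `|lam l|)%:E)%E.
Proof.
move=> c0; rewrite -esum_intZl; last 2 first.
- by move=> l; rewrite lee_fin; case: ifP => // _; rewrite mulr_ge0// ltW.
- by rewrite mulr_ge0// powR_ge0.
apply: eq_esum => l _; rewrite -EFinM /decay; case: ifP => _; last first.
  by rewrite !mulr0 mul0r.
congr EFin; rewrite /M powRD; last by rewrite (gt_eqF b0) implybT.
ring.
Qed.

Lemma block_sum_in_grand_herz (p theta : R) : 1 <= p ->
  (grand_norm p theta (fun k => `|lam k|%:E) < +oo)%E ->
  in_grand_herz A P alpha p q theta f.
Proof.
move=> p1 gl; have mf := measurable_block_sum.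
have [B B1 hB] := weight_annulus; have B0 : 0 < B by exact: lt_le_trans B1.
have [S S0 [S1 S2]] := decay_summable.
pose c k l : R := 2 * B * decay k l.
have BB0 : 0 <= 2 * B by rewrite mulr_ge0// ltW.
have c0 k l : 0 <= c k l by rewrite mulr_ge0// decay_ge0.
have K0 : 0 < 2 * B * S by rewrite !mulr_gt0.
have d0 k l : (0 <= (decay k l)%:E)%E by rewrite lee_fin decay_ge0.
have c1 k : (\esum_(l in [set: int]) (c k l)%:E <= (2 * B * S)%:E)%E.
  under eq_esum do rewrite EFinM.
  by rewrite esum_intZl// [leRHS]EFinM lee_wpmul2l ?lee_fin.
have c2 l : (\esum_(k in [set: int]) (c k l)%:E <= (2 * B * S)%:E)%E.
  under eq_esum do rewrite EFinM.
  by rewrite esum_intZl// [leRHS]EFinM lee_wpmul2l ?lee_fin.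
pose v k : \bar R := (\esum_(l in [set: int]) (c k l * `|lam l|)%:E)%E.
have vT k : ((B * b `^ (k%:~R * al k))%:E * T k = v k)%E.
  by rewrite weighted_tail_mass ?(ltW B0).
have v0 k : (0 <= v k)%E by apply: esum_ge0 => l _; rewrite lee_fin mulr_ge0.
(* v k dominates the norm of the weighted piece of index k *)
have schur s : 1 <= s -> (\esum_(k in [set: int]) v k `^ s <=
    ((2 * B * S) `^ s)%:E * \esum_(k in [set: int]) (`|lam k|%:E) `^ s)%E.
  by move=> s1; apply: esum_schur.
split.
  move=> E cE E0; split; first exact: measurable_funTS mf.
  have [k Ek] := compact_off_dball cE E0.
  have Tk : (T k < +oo)%E.
    have [s s1 hs] := grand_norm_esum_lty p1 gl.
    have vs : (\esum_(k in [set: int]) v k `^ s < +oo)%E.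
      apply: le_lt_trans (schur s s1) _.
      by rewrite lte_mul_pinfty// lee_fin powR_ge0.
    have := esum_poweR_lty (lt_le_trans ltr01 s1) v0 vs k.
    rewrite -vT; apply: contraTT; rewrite -!leNgt !leye_eq => /eqP ->.
    by rewrite gt0_muley// lte_fin mulr_gt0// powR_gt0.
  have T0 : (0 <= T k)%E.
    by apply: esum_ge0 => l _; rewrite lee_fin; case: ifP => // _; rewrite mulr_ge0// ltW.
  have Tf : T k = (fine (T k))%:E by rewrite fineK// ge0_fin_numE.
  pose s := fine (T k) + 1.
  have s0 : 0 < s by rewrite ltr_wpDl// fine_ge0.
  have mE : measurable (E : set (lebT R n)).
    apply: closed_measurable_lebT; apply: compact_closed cE.
    exact: norm_hausdorff.
  apply: le_lt_trans (ltry s); apply: Lq_norm_le => //.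
  apply: le_trans (modular_block_sum (k := k) s0 _); last first.
    by rewrite Tf lee_fin lerDl.
  by apply: modular_subset; [exact: mD|exact: mE|exact: mq|exact: q1|
    exact: measurable_normZ|exact: Ek].
apply: (@le_lt_trans _ _ ((2 * B * S)%:E * grand_norm p theta (fun k => `|lam k|%:E))%E).
  apply: le_grand_norm => // s s1; apply: le_trans (schur s s1).
  apply: le_esum => k _; apply: le_poweR; first exact: le_trans s1.
    exact: Lq_norm_ge0.
  rewrite -vT; apply: Lq_norm_weighted_piece_le => // x kx.
  by have [] := hB k x kx.
by rewrite lte_mul_pinfty// lee_fin ltW.
Qed.

End synthesis.

End herz.

Theorem theorem3p1 (R : realType) (n : nat)
    (A : 'M[R]_n.+1) (hA : dilation A)
    (P : 'M[R]_n.+1) (hP : P \in unitmx)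
    (hvol : @lebesgue R n (ellipsoid P) = 1%E)
    (r : R) (hr : 1 < r)
    (hsub1 : ellipsoid P `<=` *:%R r @` ellipsoid P)
    (hsub2 : *:%R r @` ellipsoid P `<=` mulmx A @` ellipsoid P)
    (p : R) (hp : 1 <= p) (theta : R) (htheta : 0 < theta)
    (q : 'cV[R]_n.+1 -> R) (hq : exponent q)
    (alpha : 'cV[R]_n.+1 -> R)
    (halpha : alpha \in Lfun (@lebesgue R n) +oo%E)
    (halpha0 : log_holder_origin alpha)
    (aoo : R) (halphaoo : log_holder_infinity alpha aoo)
    (ha0 : 0 < alpha 0) (haoo : 0 < aoo)
    (f : 'cV[R]_n.+1 -> R) :
  in_grand_herz A P alpha p q theta f
  <->
  (exists (lambda : int -> R) (a : int -> 'cV[R]_n.+1 -> R),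
    [/\ \forall x \ae @lebesgue R n,
          bilateral_sum (fun k => lambda k * a k x) (f x),
        forall k, central_block A P alpha aoo q k (a k) &
        (grand_norm p theta (fun k => `|lambda k|%:E) < +oo)%E]).
Proof.
have b1 := dilation_det_gt1 hA.
have uA : A \is a GRing.unit.
  change (A \in unitmx); rewrite unitmxE unitfE -normr_gt0.
  exact: lt_trans b1.
have [mq q1 _ _] := hq.
have malpha : measurable_on setT alpha.
  by have := sub_Lfun_mfun halpha; rewrite inE.
split.
  exact: (grand_herz_block_decomposition b1 uA hP hr hsub2 mq q1 malpha).
move=> [lam [a [fa blk lamoo]]].
exact: (block_sum_in_grand_herz b1 uA hP hr hsub2 mq q1 malpha ha0 haoo
  halpha0 halphaoo fa blk hp lamoo).
Qed.
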